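(* Let $G$ be a finite simple $2$-connected graph. If $G$ is $\{K_{1,3},N_{1,1,2},H_{1,1}\}$-heavy, then $G$ is Hamiltonian.
   Context: Let $G$ be a graph on $n$ vertices. An induced subgraph $H'$ of $G$ is called heavy if there exist two nonadjacent vertices in $H'$ whose degree sum in $G$ is at least $n$. For a graph $H$, $G$ is $H$-heavy if every induced subgraph of $G$ isomorphic to $H$ is heavy; for a family $\mathcal{H}$, $G$ is $\mathcal{H}$-heavy if it is $H$-heavy for every $H\in\mathcal{H}$. $K_{1,3}$ is the claw (star with three leaves). $N_{1,1,2}$ is the graph on 7 vertices obtained from a triangle $abc$ by attaching a pendant edge at $a$, a pendant edge at $b$, and a pendant path of length $2$ at $c$. $H_{1,1}$ is the graph on 7 vertices obtained from the hourglass (two triangles $cab$ and $cde$ sharing exactly the vertex $c$) by attaching one pendant edge at $a$ and one pendant edge at $b$. *)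

(* Defs.v *)
From mathcomp Require Import all_boot.

Set Implicit Arguments.
Unset Strict Implicit.
Unset Printing Implicit Defensive.

Record sgraph := SGraph {
  vertex :> finType;
  edge : rel vertex;
  edge_sym : symmetric edge;
  edge_irrefl : irreflexive edge }.

Arguments edge {s} x y.

Definition degree (G : sgraph) (x : G) : nat := #|[set y : G | edge x y]|.

Definition isomorphic (G H : sgraph) : Prop :=
  exists2 f : G -> H, bijective f & forall x y, edge (f x) (f y) = edge x y.

Section Induced.
Variables (G : sgraph) (S : {set G}).

Definition induced_edge : rel {x : G | x \in S} :=
  fun x y => edge (val x) (val y).

Lemma induced_edge_sym : symmetric induced_edge.
Proof. by move=> x y; rewrite /induced_edge edge_sym. Qed.

Lemma induced_edge_irrefl : irreflexive induced_edge.
Proof. by move=> x; rewrite /induced_edge edge_irrefl. Qed.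

Definition induced : sgraph := SGraph induced_edge_sym induced_edge_irrefl.

End Induced.

(* The empty graph is vacuously connected, but [k_connected] never tests it:
   its cardinality condition keeps [~: X] nonempty. *)
Definition connected (G : sgraph) : Prop := forall x y : G, connect edge x y.

Definition k_connected (k : nat) (G : sgraph) : Prop :=
  k < #|G| /\ forall X : {set G}, #|X| < k -> connected (induced (~: X)).

Definition hamiltonian (G : sgraph) : Prop :=
  exists c : seq G, [/\ 2 < size c, ucycle edge c & forall x : G, x \in c].

(* Degrees and order are those of [G], not of [induced S]. *)
Definition heavy (G : sgraph) (S : {set G}) : Prop :=
  exists x y : induced S,
    [/\ x != y, ~~ edge x y & #|G| <= degree (val x) + degree (val y)].

Definition graph_heavy (H G : sgraph) : Prop :=
  forall S : {set G}, isomorphic (induced S) H -> heavy S.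

Definition family_heavy (F : sgraph -> Prop) (G : sgraph) : Prop :=
  forall H : sgraph, F H -> graph_heavy H G.

Section EdgeList.
Variables (n : nat) (E : seq (nat * nat)).

Definition list_edge : rel 'I_n := fun i j =>
  (i != j) && (((val i, val j) \in E) || ((val j, val i) \in E)).

Lemma list_edge_sym : symmetric list_edge.
Proof. by move=> i j; rewrite /list_edge eq_sym orbC. Qed.

Lemma list_edge_irrefl : irreflexive list_edge.
Proof. by move=> i; rewrite /list_edge eqxx. Qed.

Definition graph_of_edges : sgraph := SGraph list_edge_sym list_edge_irrefl.

End EdgeList.

Definition K13 : sgraph := graph_of_edges 4 [:: (0, 1); (0, 2); (0, 3)].

(* triangle a = 0, b = 1, c = 2; pendant edges a-3 and b-4; path c-5-6 *)
Definition N112 : sgraph :=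
  graph_of_edges 7
    [:: (0, 1); (0, 2); (1, 2); (0, 3); (1, 4); (2, 5); (5, 6)].

(* triangles c a b = 0 1 2 and c d e = 0 3 4; pendant edges a-5 and b-6 *)
Definition H11 : sgraph :=
  graph_of_edges 7
    [:: (0, 1); (0, 2); (1, 2); (0, 3); (0, 4); (3, 4); (1, 5); (2, 6)].

(* Main.v *)
(* Two vertices are ore-adjacent if they are adjacent or their degree sum is at
   least |G|.  By Ore's exchange argument the longest cycle C of G has maximum
   length even among the cycles of the ore graph, so a rerouting of C may use ore
   edges; in this relation every claw has two adjacent leaves.

   If C misses a vertex, 2-connectedness gives a path P outside C joining two
   vertices x, y of C.  Around x and y we grow "hubs", segments of C that can be
   traversed in all the ways needed to reroute C through P.  A hub absorbs the next
   vertex of C when it is ore-adjacent to a second vertex of the hub, and both next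
   vertices when these are ore-adjacent to each other.  The two hubs never meet, for
   otherwise C could be made longer, so the growth stops; and the two hubs cannot
   both contain a pair of degree sum at least |G|.  In a hub without such a pair
   claw-freeness produces a triangle x p1 p2 with pendant vertices n1, n2.  A leg
   x w v leaving C at w turns it into an N112 or an H11 that is not heavy, unless x
   and v are nonadjacent with degree sum at least |G|.  In that last case counting
   neighbours yields two vertices w, w2 outside C with so many common neighbours
   outside C that a cycle of the ore graph through them is longer than C. *)

Require Import Defs.
From mathcomp Require Import all_boot zify.

Set Implicit Arguments.
Unset Strict Implicit.
Unset Printing Implicit Defensive.

(** * Walks and hubs *)

Lemma count_cons (T : Type) (P : pred T) x s : count P (x :: s) = P x + count P s.
Proof. by []. Qed.

Lemma uniq_catl (T : eqType) (s1 s2 : seq T) : uniq (s1 ++ s2) -> uniq s1.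
Proof. by rewrite cat_uniq => /andP[]. Qed.

(** Lists are permutations of each other when every predicate [P] has equal counts on them; on
    concatenations and reversals counts are sums, which leaves linear arithmetic. *)
Ltac perm_solve :=
  let P := fresh "P" in
  apply/permP => P;
  repeat match goal with
  | H : is_true (perm_eq _ _) |- _ => move/permP/(_ P): H => H
  end;
  repeat match goal with
  | H : count P _ = count P _ |- _ =>
    rewrite -?cats1 ?(count_cat, count_rev, count_cons) /= in H; revert H
  end;
  rewrite -?cats1 ?(count_cat, count_rev, count_cons) /=; clear; lia.

Section Paths.
Variables (T : eqType) (e : rel T).
Hypothesis esym : symmetric e.

Definition walk (u v : T) (p : seq T) : bool :=
  if p is h :: t then [&& h == u, path e h t & last h t == v] else false.

(* [q] lists the interior vertices only and may be empty. *)
Definition arc (u : T) (q : seq T) (v : T) : bool := path e u (rcons q v).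

Lemma walkP u v p :
  reflect (exists t, [/\ p = u :: t, path e u t & last u t = v]) (walk u v p).
Proof.
case: p => [|h t] /=; first by constructor; case=> t [].
apply: (iffP and3P) => [[/eqP -> pt /eqP <-]|[t' [[-> ->] pt <-]]]; last by [].
by exists t.
Qed.

Lemma walk1 u : walk u u [:: u].
Proof. by rewrite /= !eqxx. Qed.

Lemma arc_cat w u p q v z p' :
  walk w u p -> arc u q v -> walk v z p' -> walk w z (p ++ q ++ p').
Proof.
move=> /walkP[t [-> pt lt]]; rewrite /arc => aq /walkP[t' [-> pt' lt']].
apply/walkP; exists (t ++ q ++ v :: t'); split=> //.
  by rewrite -cat_rcons !cat_path pt lt aq last_rcons.
by rewrite !last_cat /= lt'.
Qed.

Lemma walk_cat w u p v z p' :
  walk w u p -> e u v -> walk v z p' -> walk w z (p ++ p').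
Proof. by move=> wp uv; apply: (@arc_cat _ u _ [::] v) => //; rewrite /arc /= uv. Qed.

Lemma walk_cons w u v p : e w u -> walk u v p -> walk w v (w :: p).
Proof. by move=> wu; apply: (walk_cat (walk1 w) wu). Qed.

Lemma walk_rcons u v w p : walk u v p -> e v w -> walk u w (rcons p w).
Proof. by move=> uv vw; rewrite -cats1; apply: (walk_cat uv vw (walk1 w)). Qed.

Lemma walk_rev u v p : walk u v p -> walk v u (rev p).
Proof.
move=> /walkP[t [-> pt lt]].
elim: t u pt lt => [|a t IH] u /=; first by move=> _ ->; rewrite !eqxx.
case/andP=> ua pt lt; rewrite rev_cons.
by apply: (walk_rcons (IH _ pt lt)); rewrite esym.
Qed.

Lemma arc_rev u q v : arc u q v -> arc v (rev q) u.
Proof.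
rewrite /arc => aq; have: walk u v (u :: rcons q v) by rewrite /= eqxx aq last_rcons eqxx.
move/walk_rev; rewrite rev_cons rev_rcons /= => /and3P[_ pr _].
exact: pr.
Qed.

Lemma walk_split u v l1 a b l2 : walk u v (rcons l1 a ++ b :: l2) ->
  [/\ walk u a (rcons l1 a), e a b & walk b v (b :: l2)].
Proof.
case: l1 => [|h l1] /=; first by case/and3P=> -> /andP[-> ->] ->; rewrite !eqxx.
rewrite cat_path last_cat /= last_rcons => /and3P[-> /and3P[-> -> ->] ->].
by rewrite !eqxx.
Qed.

Lemma walk_prefix u v l1 a r : walk u v (rcons l1 a ++ r) -> walk u a (rcons l1 a).
Proof.
case: r => [|b r]; last by case/walk_split.
rewrite cats0 => pr; case/walkP: (pr) => t [et _ lt].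
have := congr1 (last u) et; rewrite last_rcons /= lt => av.
by move: pr; rewrite av.
Qed.

Lemma walk_suffix u v r b l2 : walk u v (r ++ b :: l2) -> walk b v (b :: l2).
Proof.
case/lastP: r => [|r a]; last by case/walk_split.
by move=> pr; case/walkP: (pr) => t [[bu _] _ _]; move: pr; rewrite bu.
Qed.

Lemma arc_rcons u q w v : arc u (rcons q w) v = arc u q w && e w v.
Proof. by rewrite /arc rcons_path last_rcons. Qed.

Lemma arc_walk u w m c v : arc u (w :: rcons m c) v -> walk w c (w :: rcons m c).
Proof.
rewrite /arc /= rcons_path => /and3P[_ pc _].
by rewrite pc last_rcons !eqxx.
Qed.

Lemma walk_nth z u v p i : walk u v p -> i.+1 < size p -> e (nth z p i) (nth z p i.+1).
Proof. by case/walkP=> t [-> pt _] hi; apply: (pathP z pt). Qed.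

Lemma walk_nth0 z u v p : walk u v p -> nth z p 0 = u.
Proof. by case/walkP=> t [-> _ _]. Qed.

Lemma walk_nth_last z u v p : walk u v p -> nth z p (size p).-1 = v.
Proof. by case/walkP=> t [-> _ <-]; rewrite nth_last /=; case: t. Qed.

Lemma walk_cycle u v p : walk u v p -> e v u -> cycle e p.
Proof. by move=> /walkP[t [-> pt lt]] vu; rewrite /= rcons_path pt lt. Qed.

Lemma walk_mem1 u v p : walk u v p -> u \in p.
Proof. by move=> /walkP[t [-> _ _]]; rewrite mem_head. Qed.

Lemma walk_mem2 u v p : walk u v p -> v \in p.
Proof. by move=> /walkP[t [-> _ <-]]; rewrite mem_last. Qed.

(** [D] matters only up to permutation; for a repetition-free [D] this is a Hamiltonian path of
    [D]. *)
Definition ham_walk (D : seq T) (u v : T) : Prop := exists2 p, walk u v p & perm_eq p D.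

Definition linked (D : seq T) (u v w s : T) : Prop :=
  exists p p', [/\ walk u v p, walk w s p' & perm_eq (p ++ p') D].

Lemma ham_walk_sym D u v : ham_walk D u v -> ham_walk D v u.
Proof. by case=> p /walk_rev pr pD; exists (rev p) => //; perm_solve. Qed.

Lemma linked_sym D u v w s : linked D u v w s -> linked D v u w s.
Proof.
by case=> p [p' [/walk_rev pr pp' pD]]; exists (rev p), p'; split=> //; perm_solve.
Qed.

(* A hub with terminals [a], [b], [c] can be spanned by a walk between any two
   terminals.  The last condition says moreover that, for a terminal [t] and a
   vertex [s <> t], the other two terminals are joined by a spanning walk of [D]
   that uses the (possibly absent) edge [t s]; deleting this edge leaves one of the
   two decompositions below.  The condition is what lets a hub grow. *)
Definition hub (D : seq T) (a b c : T) : Prop :=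
  [/\ ham_walk D a b, ham_walk D a c, ham_walk D b c &
      forall s, s \in D ->
      [/\ s != a -> linked D a c b s \/ linked D a b c s,
          s != b -> linked D b c a s \/ linked D a b c s
        & s != c -> linked D b c a s \/ linked D a c b s]].

Lemma hub_swap D a b c : hub D a b c -> hub D b a c.
Proof.
case=> ab ac bc J; split=> //; first exact: ham_walk_sym.
move=> s /J[Ja Jb Jc]; split=> [/Jb|/Ja|/Jc]; case=> h; try by [left|right];
  by right; apply: linked_sym.
Qed.

(** Every [s] is a terminal here: it forms one walk by itself, and the edge between the other two
    terminals is the second walk. *)
Lemma hub_triangle a b c : e a b -> e a c -> e b c -> hub [:: a; b; c] a b c.
Proof.
move=> ab ac bc; split.
- exists [:: a; c; b]; last by perm_solve.
  by rewrite /= !eqxx ac (esym c) bc.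
- by exists [:: a; b; c]; rewrite //= !eqxx ab bc.
- exists [:: b; a; c]; last by perm_solve.
  by rewrite /= !eqxx ac (esym b) ab.
move=> s; rewrite !inE => sD.
have la : linked [:: a; b; c] b c a a.
  by exists [:: b; c], [:: a]; split; rewrite /= ?eqxx ?bc //; perm_solve.
have lb : linked [:: a; b; c] a c b b.
  by exists [:: a; c], [:: b]; split; rewrite /= ?eqxx ?ac //; perm_solve.
have lc : linked [:: a; b; c] a b c c.
  by exists [:: a; b], [:: c]; split; rewrite /= ?eqxx ?ab //; perm_solve.
by case/or3P: sD => /eqP ->; split; rewrite ?eqxx; auto.
Qed.

Lemma hub_mem D a b c : hub D a b c -> [/\ a \in D, b \in D & c \in D].
Proof.
case=> [[p pp pD]] [r pr rD] _ _.
by rewrite -(perm_mem pD) (walk_mem1 pp) -(perm_mem pD) (walk_mem2 pp) -(perm_mem rD)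
  (walk_mem2 pr).
Qed.

Lemma ham_walk_cons D a b a' : e a a' -> ham_walk D a b -> ham_walk (a' :: D) a' b.
Proof.
move=> aa' [p pp pD]; exists (a' :: p); last by perm_solve.
by apply: walk_cons pp; rewrite esym.
Qed.

Lemma linked_cons D a b c s a' : e a a' -> linked D a b c s -> linked (a' :: D) a' b c s.
Proof.
move=> aa' [p [p' [pp pp' pD]]]; exists (a' :: p), p'; split=> //; last by perm_solve.
by apply: walk_cons pp; rewrite esym.
Qed.

Lemma linked_cons2 D b c a s a' : e a a' -> linked D b c a s -> linked (a' :: D) b c a' s.
Proof.
move=> aa' [p [p' [pp pp' pD]]]; exists p, (a' :: p'); split=> //; last by perm_solve.
by apply: walk_cons pp'; rewrite esym.
Qed.

Lemma ham_walk_lk D b c a : ham_walk D b c -> linked (a :: D) b c a a.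
Proof.
case=> p pp pD; exists p, [:: a]; split; rewrite ?walk1 //; perm_solve.
Qed.

(** Walk from [b] to [w], step to [a'], return along [q] to [a] and continue to [c]. *)
Lemma linked_insert D a c b w q a' :
  linked D a c b w -> arc a q a' -> e a' w -> ham_walk (rcons q a' ++ D) b c.
Proof.
case=> p [p' [pp pp' pD]] aq a'w.
exists (p' ++ a' :: rev q ++ p); last by perm_solve.
apply: (walk_cat pp' (v := a')); first by rewrite esym.
exact: arc_cat (walk1 a') (arc_rev aq) pp.
Qed.

(* If [s] is the old terminal [a], the edge from [a'] to [w] is used instead of
   the one from [a'] to [a]. *)
Lemma hub_grow D a b c a' w :
  hub D a b c -> a' \notin D -> e a a' -> w \in D -> w != a -> e a' w ->
  hub (a' :: D) a' b c.
Proof.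
move=> [ab ac bc J] a'D aa' wD wa a'w.
have aa1 : arc a [::] a' by rewrite /arc /= aa'.
have [/(_ wa) Jw _ _] := J _ wD.
split; [exact: (ham_walk_cons aa') | exact: (ham_walk_cons aa') | |].
  (* A spanning walk from [b] to [c] has [a'] in its interior; it passes through [a'] along [a a']
     and [a' w]. *)
  case: Jw => [l|l]; first exact: (linked_insert l aa1 a'w).
  by apply: ham_walk_sym; apply: (linked_insert l aa1 a'w).
move=> s; rewrite inE; case: (s =P a') => [-> _|_ /= /J[Ja Jb Jc]].
  by split=> // _; left; apply: ham_walk_lk.
split=> [_|/Jb[]|/Jc[]].
- case: (s =P a) => [->|/eqP/Ja[]]; last 2 first.
  + by left; exact: (linked_cons aa').
  + by right; exact: (linked_cons aa').
  case: Jw => [[p [p' [pp pp' pD]]]|[p [p' [pp pp' pD]]]].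
  + right; exists (a' :: rev p'), (rev p); split; [|exact: walk_rev|perm_solve].
    by apply: walk_cons a'w _; apply: walk_rev.
  + left; exists (a' :: rev p'), (rev p); split; [|exact: walk_rev|perm_solve].
    by apply: walk_cons a'w _; apply: walk_rev.
- by left; exact: (linked_cons2 aa').
- by right; exact: (linked_cons aa').
- by left; exact: (linked_cons2 aa').
- by right; exact: (linked_cons aa').
Qed.

(** For [s = a] or [s = b] the old hub's own clause is void; then the rung [a' b'] is one walk and a
    spanning walk of [D] from [c] to [s] the other. *)
Lemma hub_rung D a b c a' b' :
  hub D a b c -> a' \notin D -> b' \notin D ->
  e a a' -> e b b' -> e a' b' -> hub [:: a', b' & D] a' b' c.
Proof.
move=> [ab ac bc J] a'D b'D aa' bb' a'b'.
have b'a' : e b' a' by rewrite esym.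
have perm2 q : perm_eq (b' :: a' :: q) [:: a', b' & q] by perm_solve.
have hpp D1 D2 u v : perm_eq D1 D2 -> ham_walk D1 u v -> ham_walk D2 u v.
  by move=> P12 [p pp pD]; exists p => //; apply: perm_trans P12.
have lkp D1 D2 u v w s : perm_eq D1 D2 -> linked D1 u v w s -> linked D2 u v w s.
  by move=> P12 [p [p' [pp pp' pD]]]; exists p, p'; split=> //; apply: perm_trans P12.
have a'b2 : ham_walk [:: a', b' & D] a' b'.
  by apply: ham_walk_cons aa' _; apply/ham_walk_sym/(ham_walk_cons bb')/ham_walk_sym.
have a'c : ham_walk [:: a', b' & D] a' c.
  case: (ham_walk_cons bb' bc) => p pp pD; exists (a' :: p); last by perm_solve.
  exact: walk_cons pp.
have b'c : ham_walk [:: a', b' & D] b' c.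
  case: (ham_walk_cons aa' ac) => p pp pD; exists (b' :: p); last by perm_solve.
  exact: walk_cons pp.
have la : linked [:: a', b' & D] b' c a' a' by apply/ham_walk_lk/(ham_walk_cons bb').
have lb : linked [:: a', b' & D] a' c b' b'.
  by apply: (lkp _ _ _ _ _ _ (perm2 D)); apply/ham_walk_lk/(ham_walk_cons aa').
split=> // s; rewrite !inE.
case: (s =P a') => [->|_ /=]; first by split=> // _; left.
case: (s =P b') => [->|_ /=]; first by split=> // _; [left | right].
move=> /J[Ja Jb Jc].
have l1 : linked D a c b s -> linked [:: a', b' & D] a' c b' s.
  by move=> l; apply: (linked_cons aa'); apply: (linked_cons2 bb').
have l2 : linked D b c a s -> linked [:: a', b' & D] b' c a' s.
  by move=> l; apply: (linked_cons2 aa'); apply: (linked_cons bb').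
have l3 : linked D a b c s -> linked [:: a', b' & D] a' b' c s.
  by move=> l; apply: (linked_cons aa'); apply/linked_sym/(linked_cons bb')/linked_sym.
have l4 u : ham_walk D c u -> linked [:: a', b' & D] a' b' c u.
  case=> p pp pD; exists [:: a'; b'], p; split=> //; last by perm_solve.
  by rewrite /= !eqxx a'b'.
split=> [_|_|/Jc[]]; auto.
- by case: (s =P a) => [->|/eqP/Ja[]]; auto; right; apply/l4/ham_walk_sym.
- by case: (s =P b) => [->|/eqP/Jb[]]; auto; right; apply/l4/ham_walk_sym.
Qed.

End Paths.

(** * Rerouting through two hubs *)

Section Surgery.
Variables (T : eqType) (f : rel T) (N : nat).
Hypotheses (fsym : symmetric f) (N_gt2 : 2 < N).
Hypothesis circ : forall p, uniq p -> 2 < size p -> cycle f p -> size p <= N.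

(** [L] lists the vertices of the cycle in whatever order makes uniqueness and size easy to
    check. *)
Lemma no_long_cycle p u v L :
  walk f u v p -> f v u -> perm_eq p L -> uniq L -> N < size L -> False.
Proof.
move=> pp vu pL uL sL; have sp := perm_size pL.
have := @circ p; rewrite (perm_uniq pL) uL (walk_cycle pp vu) sp.
by lia.
Qed.

Lemma arc_cycle u v p q : walk f u v p -> arc f v q u -> cycle f (p ++ q).
Proof.
move=> /walkP[t [-> pt lt]]; rewrite /arc => aq.
by rewrite /= rcons_cat cat_path pt lt.
Qed.

Lemma no_long_arc p u v q L :
  walk f u v p -> arc f v q u -> perm_eq (p ++ q) L -> uniq L -> N < size L -> False.
Proof.
move=> pp vu pL uL sL; have sp := perm_size pL.
have := @circ (p ++ q); rewrite (perm_uniq pL) uL (arc_cycle pp vu) sp.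
by lia.
Qed.

Lemma theta_two D1 a1 a2 D2 b1 b2 q1 q2 L :
  ham_walk f D1 a1 a2 -> ham_walk f D2 b1 b2 -> arc f a1 q1 b1 -> arc f a2 q2 b2 ->
  perm_eq (D1 ++ q1 ++ q2 ++ D2) L -> uniq L -> N < size L -> False.
Proof.
move=> [p1 pp1 pD1] [p2 pp2 pD2] aq1 aq2 pL.
apply: (no_long_arc (arc_cat (walk_rev fsym pp1) aq1 pp2) (arc_rev fsym aq2)).
by perm_solve.
Qed.

(** The edge [d e] allows a cycle through all three arcs: from [d] to [a3], across [q3], from [b3]
    to [b2], back across [q2], from [a2] to [a1], across [q1], and from [b1] to [e]. *)
Lemma theta_cross D1 a1 a2 a3 d D2 b1 b2 b3 e q1 q2 q3 L :
  linked f D1 a1 a2 a3 d -> linked f D2 b3 b2 b1 e ->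
  arc f a1 q1 b1 -> arc f a2 q2 b2 -> arc f a3 q3 b3 -> f d e ->
  perm_eq (D1 ++ q1 ++ q2 ++ q3 ++ D2) L -> uniq L -> N < size L -> False.
Proof.
case=> p1 [p2 [pp1 pp2 pD1]] [r1 [r2 [pr1 pr2 pD2]]] aq1 aq2 aq3 de pL.
have c1 := arc_cat (walk_rev fsym pp2) aq3 pr1.
have c2 := arc_cat c1 (arc_rev fsym aq2) (walk_rev fsym pp1).
have c3 := arc_cat c2 aq1 pr2.
apply: (no_long_cycle c3); first by rewrite fsym.
by perm_solve.
Qed.

(* For [d] in the first hub and [e] in the second, let I and J be the sets of
   terminals that can be linked to them.  Distinct members of I and J give a
   long cycle, so I and J are the same singleton, which the hub condition allows
   only if [d] and [e] are themselves the corresponding terminals. *)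
Lemma hub_cross D1 a1 a2 a3 d D2 b1 b2 b3 e q1 q2 q3 L :
  hub f D1 a1 a2 a3 -> hub f D2 b1 b2 b3 ->
  arc f a1 q1 b1 -> arc f a2 q2 b2 -> arc f a3 q3 b3 ->
  perm_eq (D1 ++ q1 ++ q2 ++ q3 ++ D2) L -> uniq L -> N < size L ->
  a1 != a2 -> b1 != b2 -> b1 != b3 -> d \in D1 -> e \in D2 -> f d e ->
  [\/ d = a1 /\ e = b1, d = a2 /\ e = b2 | d = a3 /\ e = b3].
Proof.
move=> [_ _ _ J1] [_ _ _ J2] aq1 aq2 aq3 pL uL sL a12 b12 b13 dD eD de.
have [Ia Ib Ic] := J1 _ dD; have [Ja Jb Jc] := J2 _ eD.
have x31 : linked f D1 a1 a2 a3 d -> linked f D2 b2 b3 b1 e -> False.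
  by move=> l1 /(linked_sym fsym) l2; apply: (theta_cross l1 l2 aq1 aq2 aq3 de _ uL sL);
    perm_solve.
have x32 : linked f D1 a1 a2 a3 d -> linked f D2 b1 b3 b2 e -> False.
  move=> /(linked_sym fsym) l1 /(linked_sym fsym) l2.
  by apply: (theta_cross l1 l2 aq2 aq1 aq3 de _ uL sL); perm_solve.
have x21 : linked f D1 a1 a3 a2 d -> linked f D2 b2 b3 b1 e -> False.
  by move=> l1 l2; apply: (theta_cross l1 l2 aq1 aq3 aq2 de _ uL sL); perm_solve.
have x23 : linked f D1 a1 a3 a2 d -> linked f D2 b1 b2 b3 e -> False.
  move=> /(linked_sym fsym) l1 /(linked_sym fsym) l2.
  by apply: (theta_cross l1 l2 aq3 aq1 aq2 de _ uL sL); perm_solve.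
have x12 : linked f D1 a2 a3 a1 d -> linked f D2 b1 b3 b2 e -> False.
  by move=> l1 l2; apply: (theta_cross l1 l2 aq2 aq3 aq1 de _ uL sL); perm_solve.
have x13 : linked f D1 a2 a3 a1 d -> linked f D2 b1 b2 b3 e -> False.
  move=> /(linked_sym fsym) l1 l2.
  by apply: (theta_cross l1 l2 aq3 aq2 aq1 de _ uL sL); perm_solve.
have I0 : [\/ linked f D1 a2 a3 a1 d, linked f D1 a1 a3 a2 d | linked f D1 a1 a2 a3 d].
  case: (eqVneq d a1) => [da1|/Ia[l|l]]; last 2 first.
  - by constructor 2.
  - by constructor 3.
  have /Ib[l|l] : d != a2 by rewrite da1.
  - by constructor 1.
  - by constructor 3.
case: I0 => l; [constructor 1 | constructor 2 | constructor 3].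
- have eb : e = b1 by apply/eqP/negPn/negP=> /Ja[/(x12 l)|/(x13 l)].
  split=> //; apply/eqP/negPn/negP=> /Ia h.
  have /Jb[m|/(x13 l) //] : e != b2 by rewrite eb.
  by case: h => [/x21|/x31]; apply.
- have eb : e = b2 by apply/eqP/negPn/negP=> /Jb[/(x21 l)|/(x23 l)].
  split=> //; apply/eqP/negPn/negP=> /Ib h.
  have /Ja[m|/(x23 l) //] : e != b1 by rewrite eb eq_sym.
  by case: h => [/x12|/x32]; apply.
- have eb : e = b3 by apply/eqP/negPn/negP=> /Jc[/(x31 l)|/(x32 l)].
  split=> //; apply/eqP/negPn/negP=> /Ic h.
  have /Ja[/(x32 l) //|m] : e != b1 by rewrite eb eq_sym.
  by case: h => [/x13|/x23]; apply.
Qed.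

(** * Detours that leave the cycle at one hub *)

Section Half.
Variables (D q : seq T) (a b x a' b' : T).
Hypotheses (Dhub : hub f D a b x) (aa' : f a a') (bb' : f b b').

(** The hub splits into a walk from [x] to one of [a], [b] and a walk from [d] to the other; [p]
    joins [x] to [d], and [q] joins [a] to [b]. *)
Lemma off_hub p w v d :
  walk f a' b' q -> walk f w v p -> f x w -> f v d -> d \in D -> d != x ->
  uniq (D ++ q ++ p) -> N < size (D ++ q ++ p) -> False.
Proof.
move=> pq pp xw vd dD dx uL sL; have [_ _ _ J] := Dhub.
have [_ _ /(_ dx)[]] := J _ dD => -[r1 [r2 [pr1 pr2 prD]]].
- have c := walk_cat (walk_cat (walk_cat pr1 xw pp) vd (walk_rev fsym pr2)) aa' pq.
  by apply: (no_long_cycle c _ _ uL sL); rewrite 1?fsym //; perm_solve.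
- have c := walk_cat (walk_cat (walk_cat pr1 xw pp) vd (walk_rev fsym pr2)) bb'
              (walk_rev fsym pq).
  by apply: (no_long_cycle c _ _ uL sL); rewrite 1?fsym //; perm_solve.
Qed.

Lemma off_exit p w v :
  walk f a' b' q -> walk f w v p -> f x w -> f v a' ->
  uniq (D ++ q ++ p) -> N < size (D ++ q ++ p) -> False.
Proof.
move=> pq pp xw va' uL sL; have [_ _ [r pr prD] _] := Dhub.
have c1 := walk_cat (walk_cat pr xw pp) va' pq.
by apply: (no_long_cycle c1 _ _ uL sL); rewrite 1?fsym //; perm_solve.
Qed.

(** Meant for a vertex [y] that lay on the cycle between [c1] and [c2]: the bypass [c1 c2] frees it
    for the detour [x w y a']. *)
Lemma on_exit l1 l2 c1 c2 w y :
  walk f a' c1 l1 -> f c1 c2 -> walk f c2 b' l2 -> f x w -> f w y -> f y a' ->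
  uniq (D ++ w :: l1 ++ y :: l2) -> N < size (D ++ w :: l1 ++ y :: l2) -> False.
Proof.
move=> pl1 cc pl2 xw wy ya' uL sL; have [_ _ [r pr prD] _] := Dhub.
have b'b : f b' b by rewrite fsym.
have c3 := walk_cons wy (walk_cons ya' (walk_cat (walk_cat pl1 cc pl2) b'b pr)).
by apply: (no_long_cycle c3 xw _ uL sL); perm_solve.
Qed.

End Half.
End Surgery.

(** * Ore adjacency *)

Section Ore.
Variable G : sgraph.
Local Notation n := #|G|.

Definition ore : rel G :=
  fun x y => (x != y) && (edge x y || (n <= degree x + degree y)).

Arguments ore : simpl never.

Lemma ore_sym : symmetric ore.
Proof. by move=> x y; rewrite /ore eq_sym edge_sym addnC. Qed.

Lemma edge_neq (x y : G) : edge x y -> x != y.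
Proof. by apply: contraTneq => ->; rewrite edge_irrefl. Qed.

Lemma edge_ore x y : edge x y -> ore x y.
Proof. by move=> xy; rewrite /ore xy (edge_neq xy). Qed.

Lemma oreN x y : ore x y -> ~~ edge x y -> n <= degree x + degree y.
Proof. by case/andP=> _ /orP[->|]. Qed.

Lemma count_card (A : pred G) (l : seq G) :
  uniq l -> count A l = #|[set y | A y] :&: [set y in l]|.
Proof.
move=> ul; rewrite -size_filter -(card_uniqP (filter_uniq A ul)) -cardsE.
by apply: eq_card => y; rewrite !inE mem_filter.
Qed.

(** Outside [l] both neighbourhoods avoid [s] and [t], so their union has at most [n - size l - 2]
    vertices; the excess is made up of common neighbours. *)
Lemma degree_count (s t : G) (l : seq G) :
  uniq [:: s, t & l] -> ~~ edge s t ->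
  degree s + degree t + size l + 2 <=
    count (edge s) l + count (edge t) l + n +
    #|[set w | [&& edge s w, edge t w & w \notin l]]|.
Proof.
move=> ul st; have ul0 : uniq l by case/and3P: ul.
rewrite !(count_card _ ul0) /degree.
set L := [set y in l]; set A := [set y | edge s y]; set B := [set y | edge t y].
rewrite -(cardsID L A) -(cardsID L B).
have -> : [set w | [&& edge s w, edge t w & w \notin l]] = (A :\: L) :&: (B :\: L).
  by apply/setP=> w; rewrite !inE; case: (edge s w) (edge t w) (w \in l) => [] [] [].
have := cardsUI (A :\: L) (B :\: L).
have sub : (A :\: L) :|: (B :\: L) \subset ~: [set y in [:: s, t & l]].
  apply/subsetP=> y; rewrite !inE; case: (y \in l); rewrite ?andbF ?orbT //= orbF.
  apply: contraL; case/orP=> /eqP ->; rewrite ?edge_irrefl 1?edge_sym ?(negbTE st) //.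
  by rewrite edge_sym (negbTE st).
have := subset_leq_card sub; have := cardsC [set y in [:: s, t & l]].
have -> : #|[set y in [:: s, t & l]]| = (size l).+2 by rewrite cardsE (card_uniqP ul).
lia.
Qed.

(** Each consecutive pair contributes at most one, as [A] on its first and [B] on its second entry;
    only [A] at the last entry and [B] at the first belong to no pair. *)
Lemma count_shift (T : Type) (A B : pred T) c l :
  path (fun c c' => ~~ (A c && B c')) c l ->
  count A (c :: l) + count B (c :: l) <= size l + A (last c l) + B c.
Proof.
elim: l c => [|c' l IH] c /=; first by lia.
case/andP=> cc' /IH /=; move: cc'.
by case: (A c); case: (B c'); case: (B c); rewrite //=; lia.
Qed.

(** Along a walk of the ore graph this counts the heavy pairs still to be replaced by edges. *)
Fixpoint defect (x : G) (p : seq G) : nat :=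
  if p is y :: p' then ~~ edge x y + defect y p' else 0.

Lemma defect_cat x p q : defect x (p ++ q) = defect x p + defect (last x p) q.
Proof. by elim: p x => //= y p IH x; rewrite IH addnA. Qed.

Lemma defect_rev x p : defect (last x p) (rev (belast x p)) = defect x p.
Proof.
elim: p x => //= y p IH x; rewrite rev_cons -cats1 defect_cat IH /= addnC addn0.
by rewrite edge_sym; case: p {IH} => //= z p; rewrite rev_cons last_rcons.
Qed.

Lemma defect_size x p : defect x p <= size p.
Proof. by elim: p x => //= y p IH x; have := IH y; case: (edge x y) => /=; lia. Qed.

Lemma defect0 x p : defect x p = 0 -> path edge x p.
Proof. by elim: p x => //= y p IH x; case: (edge x y) => //= /IH. Qed.

Lemma defect_split x p : 0 < defect x p ->
  exists p1 y p2, p = p1 ++ y :: p2 /\ ~~ edge (last x p1) y.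
Proof.
elim: p x => //= y p IH x; case: (boolP (edge x y)) => [xy /= /IH|xy _].
  by case=> p1 [z [p2 [-> yz]]]; exists (y :: p1), z, p2.
by exists [::], y, p.
Qed.

Lemma not_path_split (T : eqType) (r : rel T) x p : ~~ path r x p ->
  exists l1 a b l2, x :: p = l1 ++ [:: a, b & l2] /\ ~~ r a b.
Proof.
elim: p x => //= y p IH x; case: (boolP (r x y)) => [_ /= /IH|xy _].
  by case=> l1 [a [b [l2 [-> ab]]]]; exists (x :: l1), a, b, l2.
by exists [::], x, y, p.
Qed.

(* The closing edge is the heavy pair to be removed: its ends have either a common
   neighbour outside the cycle or a crossing pair of neighbours on it. *)
Lemma ore_improve u t : uniq (u :: t) -> 1 < size t ->
  path ore u t -> ore (last u t) u -> ~~ edge (last u t) u ->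
  (exists w, [/\ w \notin u :: t, edge (last u t) w & edge w u]) \/
  exists t', [/\ perm_eq (u :: t') (u :: t), path ore u t',
                edge (last u t') u & defect u t' <= defect u t].
Proof.
case/lastP: t => [//|m v]; rewrite last_rcons size_rcons => ut sm pt vu evu.
have dvu := oreN vu evu.
have [w|none] := pickP [pred w | [&& edge v w, edge u w & w \notin m]].
  case/and3P=> vw uw wm; left; exists w; split; rewrite // 1?edge_sym //.
  by rewrite inE mem_rcons inE !negb_or wm eq_sym (edge_neq uw) eq_sym (edge_neq vw).
right.
have uvm : uniq [:: v, u & m].
  have : perm_eq (u :: rcons m v) [:: v, u & m] by perm_solve.
  by move/perm_uniq <-.
have := degree_count uvm evu.
have -> : [set w | [&& edge v w, edge u w & w \notin m]] = set0.
  by apply/setP=> w; rewrite in_set0 inE; apply: none.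
rewrite cards0 => le_count.
case: m sm ut pt none uvm le_count => [//|c m] _ ut pt _ uvm le_count.
(* Without a crossing pair the two bounds would leave a degree sum of at most [n - 1]. *)
have [pc|] := boolP (path (fun c c' => ~~ (edge v c && edge u c')) c m).
  have := @count_shift _ (edge v) (edge u) _ _ pc; rewrite [size (c :: m)]/= in le_count.
  move: le_count dvu; case: (edge v (last c m)); case: (edge u c) => /=; clear; lia.
case/not_path_split=> l1 [a [b [l2 [em]]]]; rewrite negbK => /andP[va ub].
rewrite -rcons_cons em in pt ut *; rewrite {c m em uvm le_count}.
move: pt; rewrite rcons_cat cat_path /= => /and4P[p1 la ab p2].
(* The crossing pair permits reversing the stretch from [b] to [v]: the edges [a v] and [b u]
   replace the pair [a b] and the closing pair. *)
exists (l1 ++ [:: a, v & rev (b :: l2)]); split.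
- by perm_solve.
- have pr := rev_path ore b (rcons l2 v).
  rewrite last_rcons belast_rcons in pr.
  rewrite cat_path /= p1 la (edge_ore _) 1?edge_sym // pr.
  by rewrite (eq_path (e' := ore)) // => x y; rewrite ore_sym.
- by rewrite last_cat /= rev_cons last_rcons edge_sym.
- have dr := defect_rev b (rcons l2 v); rewrite last_rcons belast_rcons in dr.
  by rewrite !defect_cat /= dr (edge_sym a v) va !leq_add2l leq_addl.
Qed.

Lemma ore_cycle_edge (c : seq G) : uniq c -> 2 < size c -> cycle ore c ->
  exists c' : seq G, [/\ uniq c', cycle edge c' & size c <= size c'].
Proof.
case: c => [//|x0 c0].
(* The measure is lexicographic, first longer cycles and then fewer non-edges: a defect is at most
   [n], so the factor [n.+2] dominates it. Starting the defect at the last vertex makes it include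
   the closing pair. *)
have [k] := ubnP ((n - size (x0 :: c0)) * n.+2 + defect (last x0 c0) (x0 :: c0)).
elim: k x0 c0 => [//|k IH] x0 c0 lek uc sc cyc.
case: (posnP (defect (last x0 c0) (x0 :: c0))) => [/defect0|].
  move=> pe; exists (x0 :: c0); split=> //.
  by move: pe; rewrite /= rcons_path andbC.
case/defect_split=> c1 [u [c2 [ec bad]]].
(* The cycle is rotated so that the bad pair becomes the closing one. *)
have erot : rot (size c1) (x0 :: c0) = u :: c2 ++ c1 by rewrite ec rot_size_cat.
have lasteq : last u (c2 ++ c1) = last (last x0 c0) c1.
  have -> : last x0 c0 = last x0 (x0 :: c0) by [].
  by rewrite ec !last_cat /=.
set t := c2 ++ c1 in erot lasteq.
have ut : uniq (u :: t) by rewrite -erot rot_uniq.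
have st : size (u :: t) = size (x0 :: c0) by rewrite -erot size_rot.
have cyct : cycle ore (u :: t) by rewrite -erot rot_cycle.
have vu : ~~ edge (last u t) u by rewrite lasteq.
have dt : defect (last x0 c0) (x0 :: c0) = (defect u t).+1.
  have ll : last x0 c0 = last u c2.
    have -> : last x0 c0 = last x0 (x0 :: c0) by [].
    by rewrite ec !last_cat.
  by rewrite ec defect_cat /= bad /t defect_cat -ll; lia.
have szn : size (u :: t) <= n by rewrite -(card_uniqP ut) max_card.
move: cyct; rewrite /= rcons_path => /andP[pt fvu].
rewrite -st in sc lek *; rewrite dt in lek.
case: (ore_improve ut sc pt fvu vu) => [[w [wc vw wu]]|[t' [pt't pt' lu' dle]]].
  case: (IH w (u :: t)) => //.
  - have := defect_size (last w (u :: t)) (w :: u :: t).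
    have : size (w :: u :: t) <= n.
      by rewrite -(card_uniqP _) ?max_card // /= wc.
    move: lek => /= lek le_n le_d.
    have e1 : n - (size t).+1 = (n - (size t).+2).+1 by rewrite subnSK.
    have {}le_d := leq_trans le_d (leqW le_n).
    move: lek le_d; rewrite e1 mulSn /=; move: (_ * _) => z.
    by clear; set d1 := defect u t; set d2 := _ + _; lia.
  - by rewrite /= wc.
  - exact: ltnW.
  - by rewrite /= (edge_ore wu) rcons_path pt edge_ore.
  move=> c' [uc' cc' sc']; exists c'; split=> //.
  by rewrite -[_.+1]/(size (x0 :: c0)) -st; apply: ltnW.
case: (IH u t').
- by move: lek dle; rewrite (perm_size pt't) /= lu' /=; move: (_ * _); clear; lia.
- by rewrite (perm_uniq pt't).
- by rewrite (perm_size pt't).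
- by rewrite /= rcons_path pt' edge_ore.
by move=> c'; rewrite (perm_size pt't) st => -[uc' cc' sc']; exists c'.
Qed.

End Ore.

Arguments ore {G} x y : simpl never.

(** * Forbidden induced subgraphs *)

Section Forbidden.
Variable G : sgraph.

Lemma heavy_embedding (H : sgraph) (g : H -> G) :
  graph_heavy H G -> injective g -> (forall x y, edge (g x) (g y) = edge x y) ->
  exists i j : H, [/\ i != j, ~~ edge i j & #|G| <= degree (g i) + degree (g j)].
Proof.
move=> hH ginj gE; pose S := [set g x | x in H].
have gS x : g x \in S by apply: imset_f.
pose h (x : H) : induced S := exist _ (g x) (gS x).
have hinj : injective h by move=> x y /(congr1 val) /ginj.
have : #|induced S| <= #|H| by rewrite card_sig card_imset.
case/(inj_card_bij hinj) => h' hK h'K.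
case: (hH S) => [|u [v [uv euv duv]]].
  exists h'; first by exists h.
  by move=> x y; rewrite -[in RHS](h'K x) -[in RHS](h'K y) /= /induced_edge /= gE.
exists (h' u), (h' v); split.
- by rewrite (can_eq h'K).
- by move: euv; rewrite -[in X in X -> _](h'K u) -[in X in X -> _](h'K v) /=
  /induced_edge /= gE.
- by move: duv; rewrite -[in X in X -> _](h'K u) -[in X in X -> _](h'K v).
Qed.

(** Pairs that are not edges of the pattern must not even be ore-adjacent, so the list spans an
    induced copy that is not heavy. By symmetry only [i < j] has to be checked. *)
Lemma heavy_list_embedding k E (z : G) (s : seq G) :
  graph_heavy (graph_of_edges k E) G -> uniq s -> size s = k ->
  (forall i j : 'I_k, i < j ->
     if ((val i, val j) \in E) || ((val j, val i) \in E)
     then edge (nth z s i) (nth z s j) else ~~ ore (nth z s i) (nth z s j)) ->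
  False.
Proof.
move=> hH us sk hij.
have key (i j : 'I_k) : i != j ->
    if ((val i, val j) \in E) || ((val j, val i) \in E)
    then edge (nth z s i) (nth z s j) else ~~ ore (nth z s i) (nth z s j).
  move=> ij; case: (ltngtP i j) => [/hij //|/hij|/val_inj eij].
    by rewrite orbC edge_sym ore_sym.
  by rewrite eij eqxx in ij.
have ginj : injective (fun i : graph_of_edges k E => nth z s (i : 'I_k)).
  move=> i j /eqP; rewrite nth_uniq ?sk //.
  by move/eqP/val_inj.
case: (heavy_embedding hH ginj) => [x y|x [y [xy exy dxy]]].
  rewrite [RHS]/edge /= /list_edge; have [->|xy /=] := eqVneq x y.
    by rewrite edge_irrefl.
  by have := key x y xy; case: ifP => // _; apply: contraNF => /edge_ore.
have := key x y xy.
move: exy; rewrite /edge /= /list_edge xy /= => /negbTE ->.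
rewrite /ore nth_uniq ?sk //.
by rewrite -[val x == val y]/(x == y) xy dxy orbT.
Qed.

Lemma claw_ore (c p q r : G) : graph_heavy K13 G ->
  edge c p -> edge c q -> edge c r -> uniq [:: p; q; r] ->
  [|| ore p q, ore p r | ore q r].
Proof.
move=> hK cp cq cr u; apply/negP => /negP; rewrite !negb_or => /and3P[pq pr qr].
apply: (heavy_list_embedding (z := c) (s := [:: c; p; q; r]) hK) => //.
  by rewrite cons_uniq u !inE !negb_or (edge_neq cp) (edge_neq cq) (edge_neq cr).
by case=> [[|[|[|[|i]]]] hi] [[|[|[|[|j]]]] hj].
Qed.

Lemma no_ore_N112 (a b c a' b' c' c'' : G) : graph_heavy N112 G ->
  uniq [:: a; b; c; a'; b'; c'; c''] ->
  [/\ edge a b, edge a c & edge b c] -> edge a a' -> edge b b' ->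
  edge c c' -> edge c' c'' ->
  [/\ ~~ ore a b', ~~ ore a c' & ~~ ore a c''] ->
  [/\ ~~ ore b a', ~~ ore b c' & ~~ ore b c''] ->
  [/\ ~~ ore c a', ~~ ore c b' & ~~ ore c c''] ->
  [/\ ~~ ore a' b', ~~ ore a' c' & ~~ ore a' c''] ->
  ~~ ore b' c' -> ~~ ore b' c'' -> False.
Proof.
move=> hN u [ab ac bc] aa bb cc cc' [h1 h2 h3] [h4 h5 h6] [h7 h8 h9] [h10 h11 h12] h13
  h14.
apply: (heavy_list_embedding (z := a) hN u) => //.
by case=> [[|[|[|[|[|[|[|i]]]]]]] hi] [[|[|[|[|[|[|[|j]]]]]]] hj] //=; rewrite ore_sym.
Qed.

Lemma no_ore_H11 (c a b d e a' b' : G) : graph_heavy H11 G ->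
  uniq [:: c; a; b; d; e; a'; b'] ->
  [/\ edge c a, edge c b & edge a b] -> [/\ edge c d, edge c e & edge d e] ->
  edge a a' -> edge b b' ->
  ~~ ore c a' -> ~~ ore c b' ->
  [/\ ~~ ore a d, ~~ ore a e & ~~ ore a b'] ->
  [/\ ~~ ore b d, ~~ ore b e & ~~ ore b a'] ->
  [/\ ~~ ore a' d, ~~ ore a' e & ~~ ore a' b'] ->
  ~~ ore b' d -> ~~ ore b' e -> False.
Proof.
move=> hH u [ca cb ab] [cd ce de] aa bb h1 h2 [h3 h4 h5] [h6 h7 h8] [h9 h10 h11] h12 h13.
apply: (heavy_list_embedding (z := a) hH u) => //.
by case=> [[|[|[|[|[|[|[|i]]]]]]] hi] [[|[|[|[|[|[|[|j]]]]]]] hj] //=; rewrite ore_sym.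
Qed.

End Forbidden.

(** * Vertices close to a hub *)

Section OreBound.
Variables (G : sgraph) (N : nat).
Hypotheses (N_gt2 : 2 < N).
Hypothesis circ : forall p : seq G, uniq p -> 2 < size p -> cycle ore p -> size p <= N.
Hypothesis claw_heavy : graph_heavy K13 G.

Let osym := @ore_sym G.
Let no_long := no_long_cycle N_gt2 circ.

Lemma walk_ore (u v : G) p : walk edge u v p -> walk ore u v p.
Proof.
case/walkP=> t [-> pt lt]; apply/walkP; exists t; split=> //.
by apply: sub_path pt => y z; apply: edge_ore.
Qed.

Lemma arc_ore (u v : G) p : arc edge u p v -> arc ore u p v.
Proof. by apply: sub_path => y z; apply: edge_ore. Qed.

(** Claw-freeness at [v] with leaves [c1], [c2], [w]: if [w] were ore-adjacent to [c1] or [c2], it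
    could be inserted next to [v] into a cycle of length [N]. *)
Lemma skip_ore (h z c1 v c2 w : G) r1 r2 :
  walk ore h z (rcons r1 c1 ++ [:: v, c2 & r2]) -> ore z h ->
  uniq (w :: rcons r1 c1 ++ [:: v, c2 & r2]) ->
  size (rcons r1 c1 ++ [:: v, c2 & r2]) = N ->
  edge c1 v -> edge v c2 -> edge v w -> ore c1 c2.
Proof.
move=> pr zh uw sr c1v vc2 vw.
have szw : N < size (w :: rcons r1 c1 ++ [:: v, c2 & r2]) by rewrite /= sr.
have [pr1 _ pr2] := walk_split pr.
have pr' : walk ore h z (rcons (rcons r1 c1) v ++ c2 :: r2) by rewrite cat_rcons.
have [pr3 _ pr4] := walk_split pr'.
have u3 : uniq [:: c1; c2; w].
  move: uw; rewrite /= cat_rcons cat_uniq mem_cat /= !inE !negb_or.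
  by case/and5P=> /and4P[_ /eqP wc1 _ /andP[/eqP wc2 _]] _ _ /and3P[_ -> _] _;
    rewrite !(eq_sym _ w) andbT; apply/andP; split; apply/eqP.
have vc1 : edge v c1 by rewrite edge_sym.
case/or3P: (claw_ore claw_heavy vc1 vc2 vw u3) => // H.
- have c := walk_cat (walk_rcons pr1 H) (_ : ore w v) pr2.
  case: (no_long (c _) zh _ uw szw); first by rewrite osym edge_ore.
  by perm_solve.
- have c := walk_cat (walk_rcons pr3 (edge_ore vw)) (_ : ore w c2) pr4.
  case: (no_long (c _) zh _ uw szw); first by rewrite osym.
  by perm_solve.
Qed.

(** Only the exit [a'] appears; the statement for [b'] comes from the same lemmas after
    [hub_swap]. *)
Definition separated (D : seq G) (x a' v : G) : Prop :=
  (forall d, d \in D -> d != x -> ~~ ore v d) /\ ~~ ore v a'.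

Section OneSide.
Variables (D q : seq G) (a b x a' b' : G).
Hypotheses (Dhub : hub ore D a b x) (aa' : edge a a') (bb' : edge b b').
Hypotheses (pq : walk edge a' b' q) (uDq : uniq (D ++ q)) (sDq : size (D ++ q) = N).

Lemma sep_arc p w v : walk ore w v p -> ore x w -> uniq (D ++ q ++ p) -> separated D x
  a' v.
Proof.
move=> pp xw u; have sp : N < size (D ++ q ++ p).
  by rewrite catA size_cat sDq; case: (p) pp => //= ? ? _; rewrite addnS ltnS leq_addr.
split=> [d dD dx|]; apply/negP=> vd.
- exact: (off_hub osym N_gt2 circ Dhub (edge_ore aa') (edge_ore bb') (walk_ore pq) pp xw
  vd dD dx u sp).
- exact: (off_exit osym N_gt2 circ Dhub (edge_ore bb') (walk_ore pq) pp xw vd u sp).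
Qed.

Lemma sep1 w : w \notin D ++ q -> edge x w -> separated D x a' w.
Proof.
move=> wC xw; apply: (sep_arc (p := [:: w]) (walk1 _ _) (edge_ore xw)).
have : uniq (w :: D ++ q) by rewrite /= wC.
by congr is_true; apply: perm_uniq; perm_solve.
Qed.

Lemma sep2_off w v : w \notin D ++ q -> edge x w -> v \notin D ++ q -> edge w v ->
  separated D x a' v.
Proof.
move=> wC xw vC wv; apply: (sep_arc (p := [:: w; v]) _ (edge_ore xw)).
  by rewrite /= !eqxx (edge_ore wv).
have : uniq [:: w, v & D ++ q] by rewrite /= inE (negbTE (edge_neq wv)) /= wC vC.
by congr is_true; apply: perm_uniq; perm_solve.
Qed.

End OneSide.

(** [v] is taken out of the cycle, its two cycle neighbours being ore-adjacent by [skip_ore]. Then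
    [x w v] is a detour outside the shortened cycle, and closing it up would gain the vertex [w]. *)
Lemma sep2_on D q a b x a' b' w v : hub ore D a b x -> ham_walk edge D a b ->
  edge a a' -> edge b b' ->
  walk edge a' b' q -> uniq (D ++ q) -> size (D ++ q) = N ->
  w \notin D ++ q -> edge x w -> v \in q -> edge w v -> separated D x a' v.
Proof.
move=> Dhub [s ps sD] aa' bb' pq uDq sDq wC xw vq wv.
have [_ wa] := sep1 Dhub aa' bb' pq uDq sDq wC xw.
have Dhub' := hub_swap osym Dhub.
have pq' := walk_rev (@edge_sym G) pq.
have pqp : perm_eq (D ++ rev q) (D ++ q) by perm_solve.
have [_ wb] : separated D x b' w.
  by apply: (sep1 Dhub' bb' aa' pq');
    rewrite ?(perm_uniq pqp) ?(perm_size pqp) ?(perm_mem pqp).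
(* By [sep1] the neighbour [v] of [w] is neither [a'] nor [b'], so it has a cycle neighbour on each
   side within [q]. *)
have va : v != a' by apply: contraNneq wa => <-; apply: edge_ore.
have vb : v != b' by apply: contraNneq wb => <-; apply: edge_ore.
case/splitPr: vq pq uDq sDq wC {pq' pqp} => q1 q2 pq uDq sDq wC.
case/lastP: q1 pq uDq sDq wC => [|q1 c1] pq uDq sDq wC.
  by case/walkP: pq va => t [[->]]; rewrite eqxx.
case: q2 pq uDq sDq wC => [|c2 q2] pq uDq sDq wC.
  by have [_ _] := walk_split pq; rewrite /= eqxx (negbTE vb).
have [pq1 c1v pq2] := walk_split pq.
have pq' : walk edge a' b' (rcons (rcons q1 c1) v ++ c2 :: q2) by rewrite cat_rcons.
have [_ vc2 pq3] := walk_split pq'.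
have cc : ore c1 c2.
  have pc := walk_ore (walk_cat (walk_rev (@edge_sym G) ps) aa' pq).
  rewrite catA -rcons_cat in pc.
  apply: (skip_ore pc _ _ _ c1v vc2 (w := w)).
  - by rewrite osym edge_ore.
  - have : uniq (w :: D ++ rcons q1 c1 ++ [:: v, c2 & q2]) by rewrite cons_uniq wC.
    by congr is_true; apply: perm_uniq; perm_solve.
  - by rewrite -sDq; apply: perm_size; perm_solve.
  - by rewrite edge_sym.
have uw : uniq (w :: D ++ rcons q1 c1 ++ [:: v, c2 & q2]) by rewrite cons_uniq wC.
have sw : N < size (w :: D ++ rcons q1 c1 ++ [:: v, c2 & q2]) by rewrite /= sDq.
have pq0 : walk ore a' b' (rcons q1 c1 ++ c2 :: q2).
  exact: walk_cat (walk_ore pq1) cc (walk_ore pq3).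
split=> [d dD dx|]; apply/negP=> vd.
- have pw : walk ore w v [:: w; v] by rewrite /= !eqxx (edge_ore wv).
  have pe : perm_eq (D ++ (rcons q1 c1 ++ c2 :: q2) ++ [:: w; v])
    (w :: D ++ rcons q1 c1 ++ [:: v, c2 & q2]) by perm_solve.
  apply: (off_hub osym N_gt2 circ Dhub (edge_ore aa') (edge_ore bb') pq0 pw (edge_ore
    xw) vd dD dx).
    by rewrite (perm_uniq pe).
  by rewrite (perm_size pe).
- have pe : perm_eq (D ++ w :: rcons q1 c1 ++ v :: c2 :: q2)
    (w :: D ++ rcons q1 c1 ++ [:: v, c2 & q2]) by perm_solve.
  apply: (on_exit osym N_gt2 circ Dhub (edge_ore bb') (walk_ore pq1) cc (walk_ore pq3)
    (edge_ore xw) (edge_ore wv) vd).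
    by rewrite (perm_uniq pe).
  by rewrite (perm_size pe).
Qed.

Lemma sep2 D q a b x a' b' w v : hub ore D a b x -> ham_walk edge D a b ->
  edge a a' -> edge b b' ->
  walk edge a' b' q -> uniq (D ++ q) -> size (D ++ q) = N ->
  w \notin D ++ q -> edge x w -> edge w v -> v != x -> separated D x a' v.
Proof.
move=> Dhub eD aa' bb' pq uDq sDq wC xw wv vx.
case: (boolP (v \in D ++ q)) => [|vC]; last exact: (sep2_off Dhub aa' bb' pq uDq sDq wC).
rewrite mem_cat => /orP[vD|vq]; last exact: (sep2_on Dhub eD aa' bb' pq uDq sDq wC).
have [sw _] := sep1 Dhub aa' bb' pq uDq sDq wC xw.
by have := sw v vD vx; rewrite (edge_ore wv).
Qed.

End OreBound.

(** * A net at the attachment vertex *)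

Section InducedPath.
Variables (T : finType) (e : rel T).
Hypothesis eirr : irreflexive e.

(** The path is shortened along chords [i j] with [i + 1 < j] until none is left. A repeated vertex
    would then give a loop, a further chord, or equal ends. *)
Lemma shortest_path u v p : u != v -> walk e u v p ->
  exists p', [/\ walk e u v p', {subset p' <= p}, uniq p' &
    forall z i j, i.+1 < j -> j < size p' -> ~~ e (nth z p' i) (nth z p' j)].
Proof.
move=> uv; have [k] := ubnP (size p); elim: k p => [//|k IH] p ltk pp.
case: (boolP [exists i : 'I_(size p), exists j : 'I_(size p),
  (i.+1 < j) && e (nth u p i) (nth u p j)]) => [|chordless].
  case/existsP=> -[i hi] /existsP[[j hj] /= /andP[ij eij]].
  have sub : {subset rcons (take i p) (nth u p i) ++ drop j p <= p}.
    move=> y; rewrite -take_nth // mem_cat => /orP[/mem_take|/mem_drop] //.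
  have p1 : rcons (take i p) (nth u p i) ++ nth u p i.+1 :: drop i.+2 p = p.
    have hi1 : i.+1 < size p by apply: leq_trans hj; apply: ltnW.
    by rewrite -take_nth // -drop_nth // cat_take_drop.
  have [a [l ej]] : exists a l, take j p = rcons l a.
    case/lastP: (take j p) (size_takel (ltnW hj)) => [|l a _]; last by exists a, l.
    by move=> j0; rewrite -j0 in ij.
  have p2 : rcons l a ++ nth u p j :: drop j.+1 p = p.
    by rewrite -ej -drop_nth // cat_take_drop.
  have := pp; rewrite -[in X in X -> _]p1 => /walk_split[pp1 _ _].
  have := pp; rewrite -[in X in X -> _]p2 => /walk_split[_ _ pp2].
  rewrite -drop_nth // in pp2.
  case: (IH _ _ (walk_cat pp1 eij pp2)) => [|p' [pp' sp' up' cp']].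
    by move: ltk ij hj; rewrite -take_nth // size_cat size_takel // size_drop; clear; lia.
  by exists p'; split=> // y /sp'/sub.
have nochord z i j : i.+1 < j -> j < size p -> ~~ e (nth z p i) (nth z p j).
  move=> ij hj; have hi : i < size p by apply: leq_trans hj; rewrite ltnW // ltnW.
  apply: contra chordless => eij; apply/existsP; exists (Ordinal hi).
  apply/existsP; exists (Ordinal hj); rewrite /= ij.
  by rewrite (set_nth_default z) // (set_nth_default z u).
exists p; split=> //.
apply/negPn/negP => /(uniqPn u)[i [j [ij hj eij]]].
case: (ltngtP i.+1 j) ij => // [ij _|eij1 _]; last first.
  by have := walk_nth u pp (i := i); rewrite eij1 eij eirr => /(_ hj).
have := hj; rewrite leq_eqVlt => /orP[/eqP szp|hj1]; last first.
  by have := nochord u i j.+1 (leqW ij) hj1; rewrite eij (walk_nth _ pp).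
case: i ij eij => [|i] ij eij.
  have := walk_nth_last u pp; rewrite -szp /= -eij (walk_nth0 _ pp) => uv'.
  by rewrite uv' eqxx in uv.
have := nochord u i j (ltnW ij) hj; rewrite -eij (walk_nth _ pp) //.
by apply: ltn_trans hj; apply: ltnW.
Qed.

End InducedPath.

Section Tripod.
Variables (G : sgraph) (D : seq G) (a b x a' b' w0 : G).
Hypotheses (claw_heavy : graph_heavy K13 G) (N_heavy : graph_heavy N112 G).
Hypothesis xD : x \in D.
Hypotheses (ab : a != b) (xa : x != a) (xb : x != b).
Hypotheses (eD : ham_walk edge D a b) (light : {in D &, forall u v, ore u v -> edge u v}).
Hypotheses (a'D : a' \notin D) (b'D : b' \notin D) (aa' : edge a a') (bb' : edge b b').
Hypotheses (maxa : forall d, d \in D -> d != a -> ~~ ore a' d).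
Hypotheses (maxb : forall d, d \in D -> d != b -> ~~ ore b' d).
Hypotheses (a'b' : a' != b') (maxab : ~~ ore a' b').
Hypotheses (w0D : w0 \notin D) (xw0 : edge x w0).

Definition remote (v : G) : Prop :=
  [/\ forall d, d \in D -> d != x -> ~~ ore v d, ~~ ore v a' & ~~ ore v b'].

Hypothesis w0far : remote w0.

Let osym := @ore_sym G.

(* A shortest path from [a] to [b] inside the hub is prolonged to [a'] and [b'],
   and [v] is the first vertex adjacent to it on a shortest path starting at [x].
   Claw-freeness forces [v] to see exactly two consecutive vertices; this is the
   triangle of an N112 unless [v] is [x] itself. *)
Lemma tripod : exists p1 p2 n1 n2,
  [/\ [/\ edge x p1, edge x p2 & edge p1 p2], edge p1 n1, edge p2 n2,
      uniq [:: x; p1; p2; n1; n2] &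
   [/\ [/\ ~~ ore x n1, ~~ ore x n2 & ~~ ore n1 n2], ~~ ore p1 n2, ~~ ore p2 n1 &
    forall v, remote v -> [/\ ~~ ore v p1, ~~ ore v p2, ~~ ore v n1 & ~~ ore v n2]]].
Proof.
case: eD => s ps sD.
have [p [pp psub pu pch]] := shortest_path (@edge_irrefl G) ab ps.
have pD y : y \in p -> y \in D by move/psub; rewrite (perm_mem sD).
have [k kE] : exists k, k = size p by eexists.
have k1 : 1 < k.
  case/walkP: pp kE => -[|c t] [ep _ lt] ->; rewrite ep //.
  by move: ab; rewrite -lt /= eqxx.
(* [Q] is the prolonged path: [Q 0 = a'], [Q 1 = a], [Q k = b], [Q k.+1 = b']. By [QN] below it is
   induced even for [ore]. *)
pose Q i := nth x (a' :: rcons p b') i.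
have Q0 : Q 0 = a' by [].
have Qk1 : Q k.+1 = b' by rewrite /Q /= nth_rcons kE ltnn eqxx.
have Qp i : i < k -> Q i.+1 = nth x p i by move=> ik; rewrite /Q /= nth_rcons -kE ik.
have Qin i : 0 < i <= k -> Q i \in p.
  by case: i => // i /= ik; rewrite Qp // mem_nth // -kE.
have QE i : i <= k -> edge (Q i) (Q i.+1).
  have pQ : path edge a' (rcons p b').
    case/walkP: pp => t [-> pt lt] /=; rewrite edge_sym aa' rcons_path pt lt //=.
  by move=> ik; apply: (pathP x pQ); rewrite size_rcons -kE.
have QU i j : i < j -> j <= k.+1 -> Q i != Q j.
  move=> ij jk; rewrite /Q nth_uniq ?(ltn_eqF ij) //= ?size_rcons -?kE ?ltnS //.
    by apply: leq_trans jk; apply: ltnW.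
  rewrite mem_rcons inE rcons_uniq pu !negb_or a'b' /= andbT.
  by apply/andP; split; [apply: contraNN a'D | apply: contraNN b'D] => /pD.
have Q1 : Q 1 = a by rewrite Qp ?(ltnW k1) // (walk_nth0 _ pp).
have Qk : Q k = b.
  by case: (k) kE k1 Qp => // k' kE k1 Qp; rewrite Qp // -(walk_nth_last x pp) -kE.
have QN i j : i.+1 < j -> j <= k.+1 -> ~~ ore (Q i) (Q j).
  case: i => [|i] ij; rewrite leq_eqVlt => /orP[/eqP ej|jk]; rewrite ?ej ?Qk1 ?Q0 //.
  - apply: maxa; first by apply/pD/Qin; rewrite (ltnW ij) -ltnS.
    by rewrite eq_sym -Q1; apply: QU => //; apply: ltnW.
  - have ik : i.+1 < k by rewrite -ltnS -ej.
    by rewrite osym; apply: maxb; [apply/pD/Qin; rewrite /= ltnW | rewrite -Qk;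
      apply: QU].
  - case: j ij jk => // j ij jk.
    have ik : i < k := ltn_trans (ltnW (ij : i.+1 < j)) jk.
    have nij : ~~ edge (Q i.+1) (Q j.+1).
      by rewrite !Qp //; apply: pch; rewrite -?kE.
    by apply: contraNN nij; apply: light; apply/pD/Qin.
clearbody Q.
pose off t := forall i, i <= k.+1 -> ~~ ore t (Q i).
have offD t : t \in D -> t \notin p -> {in p, forall y, ~~ edge t y} -> off t.
  move=> tD tp tN [|i]; last rewrite leq_eqVlt => /orP[/eqP ->|]; rewrite ?Q0 ?Qk1 osym.
  - by move=> _; apply: maxa => //; apply: contraNneq tp => ->;
    rewrite -Q1 Qin ?(ltnW k1).
  - by apply: maxb => //; apply: contraNneq tp => ->; rewrite -Qk Qin // (ltnW k1) /=.
  - move=> ik; have yp := Qin i.+1 ik; rewrite osym.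
    by apply: contraNN (tN _ yp); apply: light => //; apply: pD.
(* If [x] lay on the path, [w0] and the two path neighbours of [x] would be leaves of a claw at [x],
   no two of them ore-adjacent. *)
have xp : x \notin p.
  apply/negP => /(nthP x)[i]; rewrite -kE => ik ex.
  have ex' : Q i.+1 = x by rewrite Qp.
  have i0 : 0 < i by case: i ik ex ex' => // _ _; rewrite Q1 => e; move: xa;
    rewrite e eqxx.
  have ik1 : i.+1 < k.
    rewrite ltn_neqAle ik andbT; apply/eqP => e.
    by move: ex'; rewrite e Qk => e'; move: xb; rewrite e' eqxx.
  have [wD wa wb] := w0far.
  have h1 : ~~ ore w0 (Q i).
    apply: wD; first by apply/pD/Qin; rewrite i0 ltnW.
    by rewrite -ex'; apply: QU => //; rewrite ltnW.
  have h2 : ~~ ore w0 (Q i.+2).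
    by apply: wD; [apply/pD/Qin | rewrite eq_sym -ex'; apply: QU; rewrite // ltnW].
  have xl : edge x (Q i) by rewrite edge_sym -[X in edge _ X]ex'; apply: QE; rewrite ltnW.
  have xr : edge x (Q i.+2) by rewrite -[X in edge X _]ex'; apply: QE.
  have u3 : uniq [:: w0; Q i; Q i.+2].
    rewrite /= !inE negb_or andbT QU ?(ltnW ik1) // andbT; apply/andP; split;
      apply: contraNneq w0D => ->; apply/pD/Qin => //.
    by rewrite i0 ltnW.
  have := claw_ore claw_heavy xw0 xl xr u3.
  by rewrite (negbTE h1) (negbTE h2) (negbTE (QN _ _ _ _)) // ltnW.
have offw0 : off w0.
  have [wD wa wb] := w0far.
  case=> [|i]; last rewrite leq_eqVlt => /orP[/eqP ->|ik]; rewrite ?Q0 ?Qk1 //.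
  have yp := Qin i.+1 ik.
  by apply: wD; [apply: pD | apply: contraNneq xp => <-].
have [r rr rsub] : exists2 r, walk edge x b r & {subset r <= D}.
  have xs : x \in s by rewrite (perm_mem sD).
  case/splitPr: xs sD ps => s1 s2 sD ps; exists (x :: s2).
    case/lastP: s1 ps {sD} => [|s1 c] ps; last by case: (walk_split ps).
    by case/walkP: ps => t [[ea _]]; move: xa; rewrite ea eqxx.
  by move=> y ys; rewrite -(perm_mem sD) mem_cat ys orbT.
have {r rr rsub} [Y [pY Ysub Yu Ych]] : exists Y, [/\ walk edge x b Y, {subset Y <= D},
    uniq Y & forall z i j, i.+1 < j -> j < size Y -> ~~ edge (nth z Y i) (nth z Y j)].
  have [Y [pY Ysub Yu Ych]] := shortest_path (@edge_irrefl G) xb rr.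
  by exists Y; split=> // y /Ysub/rsub.
have sY : 1 < size Y.
  case/walkP: pY => -[|c t] [ep _ lt]; rewrite ep //.
  by move: xb; rewrite -lt /= eqxx.
pose adj y := has (edge y) p.
have hasY : has adj Y.
  apply/(has_nthP x); exists (size Y).-2; first by case: (size Y) sY => [|[]].
  apply/hasP; exists b; first by rewrite -Qk Qin // (ltnW k1) /=.
  rewrite -(walk_nth_last x pY).
  by case: (size Y) sY (@walk_nth _ _ x _ _ _ (size Y).-2 pY) => [|[|m]] //= _; apply.
(* [y j] is the first vertex of [Y] with a neighbour on [p]; one exists because the last but one
   vertex of [Y] is adjacent to [b]. *)
pose j := find adj Y; have jY : j < size Y by rewrite -has_find.
pose y i := nth x Y i.
have y0 : y 0 = x by rewrite /y (walk_nth0 _ pY).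
have yD i : i <= j -> y i \in D by move=> ij; apply/Ysub/mem_nth/(leq_ltn_trans ij).
have yfar i : i < j -> {in p, forall t, ~~ edge (y i) t}.
  by move=> ij t tp; have /(before_find x)/hasPn := ij; apply.
have yp i : i <= j -> y i \notin p.
  case: i => [|i] ij; first by rewrite y0.
  apply/negP => yi; have := yfar i ij _ yi.
  by rewrite (walk_nth _ pY) // (leq_ltn_trans ij).
have offy i : i < j -> off (y i).
  by move=> ij; apply: offD; [apply/yD/ltnW | apply/yp/ltnW | apply: yfar].
have [v ev] : exists v, v = y j by eexists.
have vD : v \in D by rewrite ev yD.
have vp : v \notin p by rewrite ev yp.
have vadj : has (edge v) p by rewrite ev; apply: (nth_find x hasY).
(* [i0] counts along [p], so the first neighbour of [v] is [Q i0.+1], and [Q i0] precedes it. *)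
pose i0 := find (edge v) p; have i0k : i0 < k by rewrite kE -has_find.
have vQI : edge v (Q i0.+1) by rewrite Qp //; apply: (nth_find x vadj).
(* [w1] is the vertex before [v]: [w0] if [v = x], otherwise the previous vertex of [Y]. *)
have [w1 [w1off vw1]] : exists w1, off w1 /\ edge v w1.
  case: (j) ev offy jY => [|j'] ev offy jY.
    by exists w0; rewrite ev y0.
  by exists (y j'); split; [apply: offy | rewrite edge_sym ev (walk_nth _ pY)].
have va' : ~~ ore v a'.
  by rewrite osym; apply: maxa => //; apply: contraNneq vp => ->;
    rewrite -Q1 Qin ?(ltnW k1).
have vb' : ~~ ore v b'.
  by rewrite osym; apply: maxb => //; apply: contraNneq vp => ->;
    rewrite -Qk Qin // (ltnW k1) /=.
have vQ i : 0 < i <= k -> ore v (Q i) -> edge v (Q i).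
  by move=> ik; apply: light => //; apply/pD/Qin.
have vneq i : i <= k.+1 -> v != Q i.
  case: i => [|i]; last rewrite leq_eqVlt => /orP[/eqP ->|ik]; rewrite ?Q0 ?Qk1.
  - by move=> _; apply: contraNneq a'D => <-.
  - by apply: contraNneq b'D => <-.
  - by apply: contraNneq vp => ->; apply: Qin.
have w1neq i : i <= k -> w1 != Q i.
  move=> ik; apply: contraTneq (edge_ore (QE _ ik)) => <-.
  by apply: w1off.
have w1neq' : w1 != Q k.+1.
  by apply: contraTneq (edge_ore (QE _ (leqnn k))) => <-; rewrite osym; apply: w1off;
    apply: leqW.
have i0k1 : i0 <= k by apply: ltnW.
have vQl : ~~ ore v (Q i0).
  case: (posnP i0) => [->|i00]; first by rewrite Q0.
  apply/negP => /(vQ i0); rewrite i00 i0k1 => /(_ isT).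
  rewrite -(prednK i00) Qp; last by rewrite prednK.
  by rewrite before_find // prednK.
(* Claw at [Q i0.+1] with leaves [Q i0], [Q i0.+2] and [v]. *)
have vQr : ore v (Q i0.+2).
  have el : edge (Q i0.+1) (Q i0) by rewrite edge_sym QE.
  have er := QE i0.+1 i0k.
  have u3 : uniq [:: Q i0; Q i0.+2; v].
    by rewrite /= !inE negb_or QU // !(eq_sym _ v) !vneq // ltnW.
  have ev' : edge (Q i0.+1) v by rewrite edge_sym.
  have := claw_ore claw_heavy el er ev' u3.
  by rewrite (negbTE (QN _ _ _ _)) //= osym (negbTE vQl) osym.
have i0k2 : i0.+1 < k.
  rewrite ltn_neqAle i0k andbT; apply/eqP => e.
  by move: vQr; rewrite e Qk1 (negbTE vb').
have vQre : edge v (Q i0.+2) by apply: vQ.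
(* Otherwise the claw at [v] with leaves [w1], [Q i0.+1], [Q i0.+3] has no ore-adjacent leaves. *)
have vQrr : ~~ ore v (Q i0.+3).
  apply/negP => vo; have i0k3 : i0.+2 < k.
    rewrite ltn_neqAle i0k2 andbT; apply/eqP => e.
    by move: vo; rewrite e Qk1 (negbTE vb').
  have ve := vQ i0.+3 i0k3 vo.
  have u3 : uniq [:: w1; Q i0.+1; Q i0.+3].
    by rewrite /= !inE negb_or QU ?w1neq // ltnW.
  have := claw_ore claw_heavy vw1 vQI ve u3.
  by rewrite (negbTE (QN _ _ _ _)) ?(negbTE (w1off _ _)) // ltnW // ltnW.
have le3 : i0.+3 <= k.+1 by [].
have le2 : i0.+2 <= k.+1 by apply: ltnW.
have le1 : i0.+1 <= k.+1 by apply: ltnW.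
have le0 : i0 <= k.+1 by apply: ltnW.
have e10 : edge (Q i0.+1) (Q i0) by rewrite edge_sym QE.
have e12 : edge (Q i0.+1) (Q i0.+2) by apply: QE.
have e23 : edge (Q i0.+2) (Q i0.+3) by apply: QE.
have n20 : ~~ ore (Q i0.+2) (Q i0) by rewrite osym QN.
have n13 : ~~ ore (Q i0.+1) (Q i0.+3) by rewrite QN.
have n03 : ~~ ore (Q i0) (Q i0.+3) by rewrite QN // ltnW.
have u5 : uniq [:: v; Q i0.+1; Q i0.+2; Q i0; Q i0.+3].
  by rewrite /= !inE !negb_or !vneq // !(eq_sym _ (Q i0)) !QU // ltnW.
case: (posnP j) => [j0|j0].
  have vx : v = x by rewrite ev j0 y0.
  rewrite vx in u5 vQl vQrr vQI vQre.
  exists (Q i0.+1), (Q i0.+2), (Q i0), (Q i0.+3); do 2!split=> //.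
  move=> t [tD ta tb].
  have tQ i : i <= k.+1 -> ~~ ore t (Q i).
    case: i => [|i]; last rewrite leq_eqVlt => /orP[/eqP ->|ik]; rewrite ?Q0 ?Qk1 //.
    have yp' := Qin i.+1 ik.
    by apply: tD; [apply: pD | apply: contraNneq xp => <-].
  by split; apply: tQ.
(* For [j > 0] the triangle [Q i0.+1], [Q i0.+2], [v] with pendants [Q i0], [Q i0.+3] and the path
   [v], [y j.-1], [w2] is an N112 that is not heavy. Here [w2] precedes [y j.-1] and is [w0] when
   [j = 1]. *)
exfalso.
have [w2 [w12 w2off w2v]] : exists w2, [/\ edge (y j.-1) w2, off w2 & ~~ ore v w2].
  case: (posnP j.-1) => [j1|j1].
    exists w0; rewrite j1 y0; split=> //; rewrite osym.
    have [wD _ _] := w0far; apply: wD => //.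
    rewrite ev -y0; apply/eqP => /eqP; rewrite nth_uniq // ?(ltnW sY) //.
    by case: (j) j0.
  have jj : j = j.-2.+2 by case: (j) j0 j1 => [|[]].
  exists (y j.-2); split.
  - by rewrite jj /= edge_sym (walk_nth _ pY) // (leq_ltn_trans _ jY) // jj /=.
  - by apply: offy; rewrite [in X in _ < X]jj.
  - have nv : ~~ edge (y j.-2) v by rewrite ev; apply: Ych; rewrite // [in X in _ < X]jj.
    rewrite osym; apply: contraNN nv; apply: light => //; apply: yD.
    by rewrite [in X in _ <= X]jj /=; apply: leqW.
have jp : j.-1 < j by rewrite prednK.
have vw : edge v (y j.-1).
  by rewrite edge_sym ev; have := walk_nth x pY (i := j.-1); rewrite prednK //; apply.
have w1o := offy _ jp.
have dist t i : off t -> i <= k.+1 -> t != Q i.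
  move=> ot; case: (ltnP i k.+1) => ik ik'.
    by apply: contraTneq (edge_ore (QE _ ik)) => <-; apply: ot.
  have -> : i = k.+1 by apply/eqP; rewrite eqn_leq ik ik'.
  by apply: contraTneq (edge_ore (QE _ (leqnn k))) => <-; rewrite osym; apply: ot;
    apply: leqW.
have w2ne : v != w2.
  by apply: contraTneq vQr => ->; apply: w2off.
apply: (no_ore_N112 N_heavy (a := Q i0.+1) (b := Q i0.+2) (c := v) (a' := Q i0)
  (b' := Q i0.+3) (c' := y j.-1) (c'' := w2)) => //.
- have d1 : w2 != y j.-1 by rewrite eq_sym (edge_neq w12).
  have d2 : w2 != v by rewrite eq_sym.
  have d3 : y j.-1 != v by rewrite eq_sym (edge_neq vw).
  have u7 : uniq [:: w2, y j.-1 & [:: v; Q i0.+1; Q i0.+2; Q i0; Q i0.+3]].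
    rewrite cons_uniq cons_uniq u5 !inE !negb_or d1 d2 d3.
    by rewrite !(dist w2) // !(dist (y j.-1)).
  by congr is_true: u7; apply: perm_uniq; perm_solve.
- by split; rewrite // edge_sym.
- by split; rewrite // osym ?w1o ?w2off.
- by split; rewrite // osym ?w1o ?w2off.
- by split; rewrite // osym ?w1o ?w2off.
- by rewrite osym w1o.
- by rewrite osym w2off.
Qed.

End Tripod.

(** * Legs of large degree *)

(* Applied to the neighbourhoods on a longest cycle of two vertices joined by a
   walk of three vertices outside it: two such neighbours cannot be close. *)
Lemma window_count (T : Type) (A B : pred T) (l : seq T) :
  (forall r1 c1 s c2 r2, l = r1 ++ c1 :: s ++ c2 :: r2 -> size s <= 2 ->
     [/\ ~~ (A c1 && B c2), ~~ (B c1 && A c2),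
         size s = 0 -> ~~ (A c1 && A c2) & size s = 0 -> ~~ (B c1 && B c2)]) ->
  2 * (count A l + count B l) <= size l + 3.
Proof.
have [k] := ubnP (size l); elim: k l => [//|k IH] [//|c l] ltk win.
have IHs m t : l = m ++ t -> 2 * (count A t + count B t) <= size t + 3.
  move=> lt; apply: IH.
    by move: ltk; rewrite lt /= size_cat; clear; lia.
  by move=> r1 c1 s c2 r2 et; apply: (win (c :: m ++ r1)); rewrite lt et /= catA.
have near s d r : l = s ++ d :: r -> size s <= 2 ->
    [/\ ~~ (A c && B d), ~~ (B c && A d),
        size s = 0 -> ~~ (A c && A d) & size s = 0 -> ~~ (B c && B d)].
  by move=> el ss; apply: (win [::] c s d r) => //; rewrite el.
(* An entry in both [A] and [B] is followed by three entries in neither, an entry in just one by at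
   least one in neither; the slack 3 covers a window cut off by the end of the list. *)
case Ac: (A c); case Bc: (B c); rewrite /= Ac Bc.
- have none s d r : l = s ++ d :: r -> size s <= 2 -> A d = false /\ B d = false.
    by move=> el ss; case: (near s d r el ss); rewrite Ac Bc /= => /negbTE -> /negbTE ->.
  case: l {win IH ltk near} none IHs => [|d1 [|d2 [|d3 l]]] none IHs.
  + by [].
  + have [h1 h2] := none [::] d1 [::] erefl isT.
    by rewrite /= h1 h2.
  + have [h1 h2] := none [::] d1 [:: d2] erefl isT.
    have [h3 h4] := none [:: d1] d2 [::] erefl isT.
    by rewrite /= h1 h2 h3 h4.
  + have [h1 h2] := none [::] d1 [:: d2, d3 & l] erefl isT.
    have [h3 h4] := none [:: d1] d2 (d3 :: l) erefl isT.
    have [h5 h6] := none [:: d1; d2] d3 l erefl isT.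
    have := IHs [:: d1; d2; d3] l erefl.
    by rewrite /= h1 h2 h3 h4 h5 h6; clear; lia.
- case: l {win IH ltk} near IHs => [//|d l] near IHs.
  have [h1 _ h2 _] := near [::] d l erefl isT.
  have := IHs [:: d] l erefl; move: h1 (h2 erefl).
  by rewrite Ac /= => /negbTE -> /negbTE ->; clear; lia.
- case: l {win IH ltk} near IHs => [//|d l] near IHs.
  have [_ h1 _ h2] := near [::] d l erefl isT.
  have := IHs [:: d] l erefl; move: h1 (h2 erefl).
  by rewrite Bc /= => /negbTE -> /negbTE ->; clear; lia.
- by have := IHs [::] l erefl; clear; lia.
Qed.

(** Among a new vertex [v] and the first vertices of the two paths some pair is adjacent: either [v]
    extends a path, or the paths merge and [v] becomes a path of its own. *)
Lemma two_path_cover (T : eqType) (f : rel T) (s : seq T) :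
  symmetric f -> uniq s ->
  (forall p q r, p \in s -> q \in s -> r \in s -> uniq [:: p; q; r] ->
     [|| f p q, f p r | f q r]) ->
  exists p1 p2, [/\ sorted f p1, sorted f p2 & perm_eq (p1 ++ p2) s].
Proof.
move=> fsym; elim: s => [|v s IH]; first by exists [::], [::].
rewrite cons_uniq => /andP[vs us] alpha.
case: IH => // [p q r ps qs rs|p1 [p2 [s1 s2 ps]]].
  by apply: alpha; rewrite inE ?ps ?qs ?rs orbT.
case: p1 s1 ps => [|e1 p1] s1 ps.
  by exists [:: v], p2; split=> //; perm_solve.
case: p2 s2 ps => [|e2 p2] s2 ps.
  by exists [:: v], (e1 :: p1); split=> //; perm_solve.
have inS y : y \in (e1 :: p1) ++ e2 :: p2 -> y \in v :: s.
  by rewrite (perm_mem ps) inE => ->; rewrite orbT.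
have e1s : e1 \in e1 :: p1 ++ e2 :: p2 by rewrite mem_head.
have e2s : e2 \in e1 :: p1 ++ e2 :: p2 by rewrite inE mem_cat mem_head !orbT.
have u3 : uniq [:: v; e1; e2].
  have vns y : y \in e1 :: p1 ++ e2 :: p2 -> v != y.
    by rewrite (perm_mem ps) => ys; apply: contraNneq vs => ->.
  rewrite /= !inE negb_or !vns //= andbT.
  move: us; rewrite -(perm_uniq ps) /= mem_cat inE !negb_or.
  by case/andP=> /and3P[_ -> _] _.
case/or3P: (alpha v e1 e2 (mem_head _ _) (inS _ e1s) (inS _ e2s) u3) => H.
- by exists (v :: e1 :: p1), (e2 :: p2); split=> //=; [rewrite H | perm_solve].
- by exists (v :: e2 :: p2), (e1 :: p1); split=> //=; [rewrite H | perm_solve].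
- exists (rev (e1 :: p1) ++ e2 :: p2), [:: v]; split=> //; last by perm_solve.
  have : sorted f (rev (e1 :: p1)).
    by rewrite rev_sorted; case: (e1 :: p1) s1 => //= ? ?; rewrite (eq_path (e' := f)).
  rewrite rev_cons; case: (rev p1) => [|h t] /=; first by move=> _; rewrite H.
  by rewrite cat_path last_rcons /= H => ->.
Qed.

Lemma arc_sorted (T : eqType) (f : rel T) u v (p : seq T) :
  f u v -> sorted f p -> {in p, forall y, f u y} -> {in p, forall y, f y v} -> arc f u p
    v.
Proof.
rewrite /arc; case: p => [|h t] uv sp up pv /=; first by rewrite uv.
by rewrite rcons_path up ?mem_head //= pv ?mem_last // andbT.
Qed.

Section Endgame.
Variables (G : sgraph) (N : nat).
Hypotheses (N_gt2 : 2 < N).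
Hypothesis circ : forall p : seq G, uniq p -> 2 < size p -> cycle ore p -> size p <= N.
Hypotheses (claw_heavy : graph_heavy K13 G) (N_heavy : graph_heavy N112 G).
Hypothesis (H_heavy : graph_heavy H11 G).

Let osym := @ore_sym G.
Let no_long := no_long_cycle N_gt2 circ.

(* Ore's exchange argument: if [l] had consecutive vertices [c1], [c2] with [c1]
   adjacent to [s] and [c2] adjacent to [t], then [s :: rcons m t] could be inserted
   between them.  So few neighbours lie on [l], and many common ones outside. *)
Lemma exchange (h z s t : G) l m : walk ore h z l -> ore z h -> arc ore s m t ->
  uniq (l ++ s :: rcons m t) -> N < size (l ++ s :: rcons m t) ->
  ~~ edge s t -> #|G| <= degree s + degree t -> ~~ edge s z ->
  1 < #|[set w | [&& edge s w, edge t w & w \notin l]]|.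
Proof.
move=> pl zh am ul sl st dst sz.
have ustl : uniq [:: s, t & l].
  have : uniq (l ++ [:: s; t]).
    apply: subseq_uniq ul; apply: cat_subseq; first exact: subseq_refl.
    by rewrite /= eqxx -cats1 suffix_subseq.
  by congr is_true; apply: perm_uniq; perm_solve.
have := degree_count ustl st.
case/walkP: pl => t' [el pt lt]; subst l.
(* Without a crossing pair the two neighbour counts on the list sum to at most its size, as [s] is
   not adjacent to [z]; [degree_count] then leaves two common neighbours outside. *)
have [pc|] := boolP (path (fun c c' => ~~ (edge s c && edge t c')) h t').
  have := @count_shift _ (edge s) (edge t) _ _ pc.
  rewrite lt (negbTE sz); move: dst; case: (edge t h) => /=; clear; lia.
case/not_path_split=> l1 [c1 [c2 [l2 [el]]]]; rewrite negbK => /andP[sc1 tc2].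
have pl : walk ore h z (h :: t') by apply/walkP; exists t'.
move: ul sl pl; rewrite el -cat_rcons => ul sl pl _.
have [pl1 _ pl2] := walk_split pl.
have c := walk_cat (arc_cat (walk_rcons pl1 _) am (walk1 _ t)) (edge_ore tc2) pl2.
case: (no_long (c _) zh _ ul sl); first by rewrite osym edge_ore.
by perm_solve.
Qed.

Variables (x u1 v1 p1 p2 n1 n2 : G) (l : seq G).
Hypotheses (pl : walk edge u1 v1 l) (xu : edge x u1) (vx : edge v1 x) (uv : ore u1 v1).
Hypotheses (uxl : uniq (x :: l)) (sxl : size (x :: l) = N).
Hypotheses (xp1 : edge x p1) (xp2 : edge x p2) (p12 : edge p1 p2).
Hypotheses (pn1 : edge p1 n1) (pn2 : edge p2 n2).
Hypotheses (unet : uniq [:: x; p1; p2; n1; n2]).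
Hypotheses (xn1 : ~~ ore x n1) (xn2 : ~~ ore x n2) (n12 : ~~ ore n1 n2).
Hypotheses (p1n2 : ~~ ore p1 n2) (p2n1 : ~~ ore p2 n1).
Let F := [:: u1; v1; p1; p2; n1; n2].
Hypothesis far1 : forall w, w \notin x :: l -> edge x w -> {in F, forall t, ~~ ore w t}.
Hypothesis far2 : forall w v, w \notin x :: l -> edge x w -> edge w v -> v != x ->
  {in F, forall t, ~~ ore v t}.

(** The leg extends the triangle [x p1 p2] and its pendants to an H11 if [x v] is an edge, and
    otherwise to an N112. The H11 has no heavy pair, and in the N112 only [x], [v] can be one. *)
Lemma leg_heavy w v : w \notin x :: l -> edge x w -> edge w v -> v != x ->
  ore x v /\ ~~ edge x v.
Proof.
move=> wC xw wv vx'.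
have fw := far1 wC xw; have fv := far2 wC xw wv vx'.
have [h1 h2 h3 h4] : [/\ p1 \in F, p2 \in F, n1 \in F & n2 \in F].
  by rewrite !inE !eqxx !orbT.
have u7 : uniq [:: w, v & [:: x; p1; p2; n1; n2]].
  have nw t : t \in F -> w != t.
    by move=> tF; apply: contraTneq (edge_ore wv) => ->; rewrite osym fv.
  have nv t : t \in F -> v != t.
    by move=> tF; apply: contraTneq (edge_ore wv) => ->; rewrite fw.
  rewrite cons_uniq cons_uniq unet !inE !negb_or vx' (edge_neq wv).
  rewrite (nw p1) // (nw p2) // (nw n1) // (nw n2) // (nv p1) // (nv p2) // (nv n1) //
    (nv n2) //.
  by rewrite eq_sym (edge_neq xw).
have exv : ~~ edge x v.
  apply/negP => xv.
  apply: (no_ore_H11 H_heavy (c := x) (a := p1) (b := p2) (d := w) (e := v)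
    (a' := n1) (b' := n2)) => //.
  - by congr is_true: u7; apply: perm_uniq; perm_solve.
  - by split; rewrite // osym ?fw ?fv.
  - by split; rewrite // osym ?fw ?fv.
  - by split; rewrite // osym ?fw ?fv.
  - by rewrite osym fw.
  - by rewrite osym fv.
split=> //; apply/negPn/negP => xv.
apply: (no_ore_N112 N_heavy (a := p1) (b := p2) (c := x) (a' := n1) (b' := n2)
  (c' := w) (c'' := v)) => //.
- by congr is_true: u7; apply: perm_uniq; perm_solve.
- by split; rewrite // edge_sym.
- by split; rewrite // osym ?fw ?fv.
- by split; rewrite // osym ?fw ?fv.
- by split; rewrite // osym ?fw ?fv.
- by rewrite osym fw.
- by rewrite osym fv.
Qed.

Let vu : ore v1 u1. Proof. by rewrite osym. Qed.

(* If [v] lies on the longest cycle, it is first bypassed: its neighbours on the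
   cycle are ore-adjacent by claw-freeness at [v]. *)
Lemma second_leg w v : w \notin x :: l -> edge x w -> edge w v -> v != x ->
  exists w2, [/\ w2 \notin x :: l, edge x w2, edge w2 v & w2 != w].
Proof.
move=> wC xw wv vx'; have [xv exv] := leg_heavy wC xw wv vx'.
have dxv := oreN xv exv.
have fw := far1 wC xw; have fv := far2 wC xw wv vx'.
have u1F : u1 \in F by rewrite mem_head.
have v1F : v1 \in F by rewrite !inE eqxx orbT.
have am : arc ore v [:: w] x by rewrite /arc /= osym (edge_ore wv) osym (edge_ore xw).
have evx : ~~ edge v x by rewrite edge_sym.
have dvx : #|G| <= degree v + degree x by rewrite addnC.
have vv1 : ~~ edge v v1 by apply: contraNN (fv _ v1F) => /edge_ore.
(* [l'] is [l], with [v] bypassed if it lies there; the ore edge [v1 u1] closes it to a cycle that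
   misses [v], [w] and [x]. *)
have [l' [pl' ul' sl' vl' xl']] : exists l', [/\ walk ore u1 v1 l',
    uniq (l' ++ [:: v; w; x]), N < size (l' ++ [:: v; w;
      x]), {subset x :: l <= v :: x :: l'} & x \notin l'].
  case: (boolP (v \in l)) => [vl|vl].
    case/splitPr: vl pl uxl sxl wC => l1 l2 pl0 uxl0 sxl0 wC0.
    case/lastP: l1 pl0 uxl0 sxl0 wC0 => [|l1 c1] pl0 uxl0 sxl0 wC0.
      case/walkP: pl0 => t [[ev _]] _ _.
      by have := fw _ u1F; rewrite -ev (edge_ore wv).
    case: l2 pl0 uxl0 sxl0 wC0 => [|c2 l2] pl0 uxl0 sxl0 wC0.
      have [_ _] := walk_split pl0; rewrite /= eqxx /= => /eqP ev.
      by have := fw _ v1F; rewrite -ev (edge_ore wv).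
    have [pl1 c1v pl2] := walk_split pl0.
    have pl0' : walk edge u1 v1 (rcons (rcons l1 c1) v ++ c2 :: l2) by rewrite cat_rcons.
    have [_ vc2 pl3] := walk_split pl0'.
    have uw : uniq (w :: x :: rcons l1 c1 ++ [:: v, c2 & l2]) by rewrite cons_uniq wC0.
    have cc : ore c1 c2.
      have pc := walk_ore (walk_cons xu pl0).
      apply: (skip_ore N_gt2 circ claw_heavy (r1 := x :: l1) pc _ uw sxl0 c1v vc2 (w :=
        w)).
      - exact: edge_ore.
      - by rewrite edge_sym.
    exists (rcons l1 c1 ++ c2 :: l2); split.
    - exact: walk_cat (walk_ore pl1) cc (walk_ore pl3).
    - by congr is_true: uw; apply: perm_uniq; perm_solve.
    - have -> : size ((rcons l1 c1 ++ c2 :: l2) ++ [:: v; w; x]) =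
          size (w :: x :: rcons l1 c1 ++ [:: v, c2 & l2]).
        by apply: perm_size; perm_solve.
      by rewrite -sxl0 /=.
    - by move=> y; rewrite !inE !mem_cat !inE => /or3P[->|->|/or3P[]->]; rewrite ?orbT.
    - move: uxl0; rewrite /= !mem_cat !inE !negb_or.
      by case/andP=> /and4P[-> _ -> ->].
  exists l; split=> //.
  - exact: walk_ore.
  - have : uniq [:: w, v, x & l].
      move: wC; rewrite cons_uniq cons_uniq uxl !inE !negb_or vl vx' => /andP[-> ->].
      by rewrite (edge_neq wv).
    by congr is_true; apply: perm_uniq; perm_solve.
  - by rewrite size_cat -sxl /=; clear; lia.
  - by move=> y yx; rewrite inE yx orbT.
  - by case/andP: uxl.
(* With [v w x] as the piece to insert, the exchange yields two common neighbours of [v] and [x]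
   outside [l'], one of them other than [w]. *)
have := exchange pl' vu am ul' sl' evx dvx vv1.
set S := [set _ | _] => S1.
have /card_gt0P[w2] : 0 < #|S :\ w|.
  by have := cardsD1 w S; move: S1; case: (w \in S) => /=; clear; lia.
rewrite !inE => /andP[w2w /and3P[vw2 xw2 w2l]].
exists w2; split; rewrite // 1?edge_sym //.
apply/negP => /vl'; rewrite !inE (negbTE w2l) orbF => /orP[]/eqP ew.
- by rewrite ew edge_irrefl in vw2.
- by rewrite ew edge_irrefl in xw2.
Qed.

(** Few neighbours of the heavy pair [w], [w2] lie on the cycle, so at least [(N + 1) / 2] common
    ones lie outside. By claw-freeness at [w] two ore paths cover these; with [w], possibly [w2],
    and a part of the cycle they form too long a cycle. *)
Lemma endgame w v : w \notin x :: l -> edge x w -> edge w v -> v != x -> False.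
Proof.
move=> wC xw wv vx'.
have [w2 [w2C xw2 w2v w2w]] := second_leg wC xw wv vx'.
have u1F : u1 \in F by rewrite mem_head.
have v1F : v1 \in F by rewrite !inE eqxx orbT.
(* Claw at [x] with leaves [w], [w2] and [u1]. *)
have ww2 : ore w w2.
  have wu1 : w != u1.
    by apply: contraTneq (edge_ore wv) => ->; rewrite osym (far2 wC xw wv).
  have w2u1 : w2 != u1.
    by apply: contraTneq (edge_ore w2v) => ->; rewrite osym (far2 wC xw wv).
  have u3 : uniq [:: w; w2; u1] by rewrite /= !inE negb_or eq_sym w2w wu1 w2u1.
  have := claw_ore claw_heavy xw xw2 xu u3.
  by rewrite (negbTE (far1 wC xw u1F)) (negbTE (far1 w2C xw2 u1F)) !orbF.
have w2x : w2 != x by rewrite eq_sym (edge_neq xw2).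
have eww2 : ~~ edge w w2.
  by apply/negP => e; case: (leg_heavy wC xw e w2x); rewrite xw2.
have dww2 := oreN ww2 eww2.
have uww : uniq [:: w, w2 & x :: l].
  by rewrite cons_uniq cons_uniq uxl w2C inE negb_or wC eq_sym w2w.
have px : walk ore x v1 (x :: l) := walk_ore (walk_cons xu pl).
have v1x : ore v1 x := edge_ore vx.
(* The exchange with [w x w2] as inserted piece gives two common neighbours outside [l]; [m] is one
   other than [x]. *)
have [m [wm w2m mC]] : exists m, [/\ edge w m, edge w2 m & m \notin x :: l].
  have am : arc ore w [:: x] w2 by rewrite /arc /= osym (edge_ore xw) edge_ore.
  have ul : uniq (l ++ [:: w; x; w2]).
    by congr is_true: uww; apply: perm_uniq; perm_solve.
  have sl : N < size (l ++ [:: w; x; w2]).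
    by rewrite -sxl size_cat /=; clear; lia.
  have wv1 : ~~ edge w v1 by apply: contraNN (far1 wC xw v1F) => /edge_ore.
  have := exchange (walk_ore pl) vu am ul sl eww2 dww2 wv1.
  set S := [set _ | _] => S1.
  have /card_gt0P[m] : 0 < #|S :\ x|.
    by have := cardsD1 x S; move: S1; case: (x \in S) => /=; clear; lia.
  by rewrite !inE => /andP[mx /and3P[wm w2m ml]]; exists m; rewrite inE negb_or mx.
(* Replacing the segment [s] of the cycle by a longer arc [k] outside it contradicts the bound
   [N]. *)
have ins (r1 : seq G) c1 (s : seq G) c2 (r2 k : seq G) : x :: l = r1 ++ c1 :: s ++ c2 ::
  r2 -> arc ore c1 k c2 ->
    uniq (k ++ x :: l) -> size s < size k -> False.
  move=> el ak; rewrite el => uk sk.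
  have p1' : walk ore x c1 (rcons r1 c1).
    by apply: (@walk_prefix _ _ x v1 r1 c1 (s ++ c2 :: r2)); rewrite cat_rcons -el.
  have p2' : walk ore c2 v1 (c2 :: r2).
    by apply: (@walk_suffix _ _ x v1 (r1 ++ c1 :: s)); rewrite -catA /= -el.
  have c := arc_cat p1' ak p2'.
  apply: (no_long c v1x (perm_refl _)).
    have : uniq ((rcons r1 c1 ++ k ++ c2 :: r2) ++ s).
      by congr is_true: uk; apply: perm_uniq; perm_solve.
    by move/uniq_catl.
  have := congr1 size el; rewrite sxl !size_cat /= !size_cat /= !size_rcons.
  by move: sk; clear; move: (size r1) (size s) (size r2) (size k); lia.
have uk3 : uniq ([:: w; m; w2] ++ x :: l).
  have mw : w != m := edge_neq wm.
  have mw2 : w2 != m := edge_neq w2m.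
  have : uniq [:: m, w, w2 & x :: l].
    by rewrite cons_uniq uww !inE !negb_or ![m == _]eq_sym mw mw2 andbT -!(eq_sym m);
      move: mC; rewrite inE negb_or.
  by congr is_true; apply: perm_uniq; perm_solve.
have uk3' : uniq ([:: w2; m; w] ++ x :: l).
  by congr is_true: uk3; apply: perm_uniq; perm_solve.
have uw1 : uniq ([:: w] ++ x :: l) by rewrite cons_uniq wC.
have uw2 : uniq ([:: w2] ++ x :: l) by rewrite cons_uniq w2C.
(* Since [w m w2] is a walk of three vertices outside the cycle, the cycle neighbours of [w] and
   [w2] are spread apart. *)
have win := @window_count _ (edge w) (edge w2) (x :: l).
have {win} cnt : 2 * (count (edge w) (x :: l) + count (edge w2) (x :: l)) <= N + 3.
  rewrite -sxl; apply: win => r1 c1 s c2 r2 el ss; split=> [||s0|s0];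
    apply/negP => /andP[e1 e2].
  - apply: (ins _ _ _ _ _ [:: w; m; w2] el) => //.
    by rewrite /arc /= osym (edge_ore e1) (edge_ore wm) osym (edge_ore w2m) (edge_ore e2).
  - apply: (ins _ _ _ _ _ [:: w2; m; w] el) => //.
    by rewrite /arc /= osym (edge_ore e1) (edge_ore w2m) osym (edge_ore wm) (edge_ore e2).
  - apply: (ins _ _ _ _ _ [:: w] el); rewrite ?s0 //.
    by rewrite /arc /= osym (edge_ore e1) (edge_ore e2).
  - apply: (ins _ _ _ _ _ [:: w2] el); rewrite ?s0 //.
    by rewrite /arc /= osym (edge_ore e1) (edge_ore e2).
have := degree_count uww eww2; rewrite sxl.
set Q := [set _ | _] => dq.
have bigQ : N + 2 <= count (edge w) (x :: l) + count (edge w2) (x :: l) + #|Q|.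
  by move: dq dww2; clear; lia.
have QP y : y \in enum Q -> [/\ edge w y, edge w2 y, y \notin x :: l & ore x y].
  rewrite mem_enum inE => /and3P[wy w2y yC]; split=> //.
  have yx : y != x by move: yC; rewrite inE negb_or => /andP[].
  by case: (leg_heavy wC xw wy yx).
have [r1 [r2 [s1 s2 pQ]]] : exists r1 r2,
    [/\ sorted ore r1, sorted ore r2 & perm_eq (r1 ++ r2) (enum Q)].
  apply: two_path_cover (enum_uniq _) _ => // p q r /QP[wp _ _ _] /QP[wq _ _ _] /QP[wr _
    _ _].
  exact: (claw_ore claw_heavy wp wq wr).
have sQ : size r1 + size r2 = #|Q| by rewrite -size_cat (perm_size pQ) cardE.
have r1P y : y \in r1 -> y \in enum Q by rewrite -(perm_mem pQ) mem_cat => ->.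
have r2P y : y \in r2 -> y \in enum Q by rewrite -(perm_mem pQ) mem_cat orbC => ->.
have uall : uniq ((r1 ++ r2) ++ [:: w, w2 & x :: l]).
  rewrite cat_uniq; apply/and3P; split=> //; first by rewrite (perm_uniq pQ) enum_uniq.
  apply/hasPn => y yl; apply/negP; rewrite /= (perm_mem pQ) => /QP[wy w2y yC _].
  move: yl; rewrite inE => /orP[/eqP ew|]; first by rewrite ew edge_irrefl in wy.
  by rewrite inE (negbTE yC) orbF => /eqP ew; rewrite ew edge_irrefl in w2y.
(* If neither [w] nor [w2] has a neighbour on [l], then [Q] has at least [N] vertices, and [x],
   [r1], [w], [r2] form a cycle longer than [N]. *)
have [|] := boolP (has (fun y => edge w y || edge w2 y) l); last first.
  move/hasPn => none.
  have c0 z : z = w \/ z = w2 -> count (edge z) (x :: l) <= 1.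
    move=> ez; rewrite /= -[1]addn0; apply: leq_add; first by case: (edge z x).
    rewrite leqn0 -leqn0 leqNgt -has_count; apply/hasPn => y /none.
    by rewrite negb_or => /andP[]; case: ez => ->.
  have := c0 w (or_introl erefl); have := c0 w2 (or_intror erefl) => c1 c2.
  have a1 : arc ore x r1 w.
    apply: arc_sorted => //; first exact: edge_ore.
      by move=> y /r1P/QP[].
    by move=> y /r1P/QP[wy _ _ _]; rewrite osym edge_ore.
  have a2 : arc ore w r2 x.
    apply: arc_sorted => //; first by rewrite osym edge_ore.
      by move=> y /r2P/QP[wy _ _ _]; rewrite edge_ore.
    by move=> y /r2P/QP[_ _ _]; rewrite osym.
  have c := arc_cat (walk1 _ x) a1 (walk1 _ w).
  apply: (no_long_arc N_gt2 circ c a2 (perm_refl _)).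
    have : uniq ((([:: x] ++ r1 ++ [:: w]) ++ r2) ++ (w2 :: l)).
      by congr is_true: uall; apply: perm_uniq; perm_solve.
    by move/uniq_catl.
  move: bigQ sQ c1 c2; rewrite !size_cat [size [:: x]]/= [size [:: w]]/=.
  move: (count (edge w) _) (count (edge w2) _) (#|Q|) (size r1) (size r2) => k1 k2 k3 k4
    k5.
  by clear; lia.
case/hasP=> y yl wy.
have [wa [wb [ab yb uab xa [Qa Qb]]]] : exists wa wb, [/\ ore wa wb, edge wb y,
    uniq ((r1 ++ r2) ++ [:: wa, wb & x :: l]), edge x wa &
    {in enum Q, forall y, edge wa y} /\ {in enum Q, forall y, edge wb y}].
  case/orP: wy => wy.
    exists w2, w; split; rewrite 1?osym //.
      by congr is_true: uall; apply: perm_uniq; perm_solve.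
    by split=> z /QP[].
  by exists w, w2; split=> //; split=> z /QP[].
have a1 : arc ore x r1 wa.
  apply: arc_sorted => //; first exact: edge_ore.
    by move=> z /r1P/QP[].
  by move=> z /r1P/Qa wz; rewrite osym edge_ore.
have a2 : arc ore wa r2 wb.
  apply: arc_sorted => //.
    by move=> z /r2P/Qa wz; rewrite edge_ore.
  by move=> z /r2P/Qb wz; rewrite osym edge_ore.
(* From [x] through [r1], [wa], [r2], [wb] to [y], then back to [x] along either side of the cycle:
   the two lengths sum to [2 * #|Q| + N + 6], which exceeds [2 * N]. *)
have c := arc_cat (arc_cat (walk1 _ x) a1 (walk1 _ wa)) a2 (walk1 _ wb).
case/splitPr: yl pl sxl uab bigQ cnt => l1 l2 pl0 sxl0 uab bigQ cnt.
have ps := walk_ore (walk_suffix pl0).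
have pp : walk ore y u1 (rev (rcons l1 y)).
  by apply/(walk_rev osym)/walk_ore/(walk_prefix (r := l2) (v := v1)); rewrite cat_rcons.
have c1 := walk_cat c (edge_ore yb) ps.
have c2 := walk_cat c (edge_ore yb) pp.
have le1 : size r1 + size r2 + size l2 + 4 <= N.
  rewrite leqNgt; apply/negP => gt; apply: (no_long c1 v1x (perm_refl _)).
    set c0 := _ ++ _; have : uniq (c0 ++ l1).
      by congr is_true: uab; apply: perm_uniq; rewrite /c0; perm_solve.
    by move/uniq_catl.
  by rewrite !size_cat /=; move: gt; clear; move: (size r1) (size r2) (size l2); lia.
have le2 : size r1 + size r2 + size l1 + 4 <= N.
  rewrite leqNgt; apply/negP => gt.
  apply: (no_long c2 _ (perm_refl _)); first by rewrite osym edge_ore.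
    set c0 := _ ++ _; have : uniq (c0 ++ l2).
      by congr is_true: uab; apply: perm_uniq; rewrite /c0; perm_solve.
    by move/uniq_catl.
  by rewrite !size_cat size_rev size_rcons /=; move: gt; clear;
    move: (size r1) (size r2) (size l1); lia.
move: sxl0; rewrite /= size_cat /=.
move: bigQ cnt le1 le2 sQ; move: (count _ _) (count _ _) (#|Q|) (size r1) (size r2)
  (size l1) (size l2).
by clear; lia.
Qed.

End Endgame.

(** * Growing the hubs *)

Section Config.
Variables (G : sgraph) (N : nat).
Hypotheses (N_gt2 : 2 < N).
Hypothesis circ : forall p : seq G, uniq p -> 2 < size p -> cycle ore p -> size p <= N.
Hypotheses (claw_heavy : graph_heavy K13 G) (N_heavy : graph_heavy N112 G).
Hypothesis (H_heavy : graph_heavy H11 G).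

Let osym := @ore_sym G.
Let esym := @edge_sym G.

(** [S] stands for the vertices of a longest cycle, in which [u] and [v] are the neighbours of [x].
    The hub may use ore edges; the spanning walk made of edges keeps a genuine cycle at hand while
    the hub grows. *)
Definition side (D : seq G) (a b x : G) (S : seq G) : Prop :=
  [/\ hub ore D a b x, ham_walk edge D a b, uniq [:: a; b; x] &
    exists u v l, [/\ walk edge u v l, edge x u, edge v x, ore u v &
                   [/\ perm_eq (x :: l) S, u \in D & v \in D]]].

(** Neither growth step, [hub_grow] nor [hub_rung], applies at the exits [a'] and [b']. *)
Definition saturated (D : seq G) (a b a' b' : G) : Prop :=
  [/\ forall d, d \in D -> d != a -> ~~ ore a' d,
      forall d, d \in D -> d != b -> ~~ ore b' d & ~~ ore a' b'].

(** [sep1] and [sep2], applied in both directions of the cycle, make the vertices of the leg remote;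
    [tripod] then supplies the net that [endgame] asks for. *)
Lemma side_saturated D a b x a' b' q w v :
  side D a b x (D ++ q) -> saturated D a b a' b' ->
  {in D &, forall u v, ore u v -> edge u v} ->
  edge a a' -> edge b b' -> a' != b' -> walk edge a' b' q ->
  uniq (D ++ q) -> size (D ++ q) = N ->
  w \notin D ++ q -> edge x w -> edge w v -> v != x -> False.
Proof.
move=> [Dhub eD uabx [u1 [v1 [l [pl xu vx uv [pS u1D v1D]]]]]] [maxa maxb maxab] light
  aa' bb' a'b' pq uDq sDq wC xw wv vx'.
have [aD bD xD] := hub_mem Dhub.
have Dhub' := hub_swap osym Dhub; have eD' := ham_walk_sym esym eD.
have pq' := walk_rev esym pq.
have pqp : perm_eq (D ++ rev q) (D ++ q) by perm_solve.
have uDq' : uniq (D ++ rev q) by rewrite (perm_uniq pqp).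
have sDq' : size (D ++ rev q) = N by rewrite (perm_size pqp).
have rem1 t : t \notin D ++ q -> edge x t -> remote D x a' b' t.
  move=> tC xt; have [h1 h2] := sep1 N_gt2 circ Dhub aa' bb' pq uDq sDq tC xt.
  rewrite -(perm_mem pqp) in tC.
  by have [_ h3] := sep1 N_gt2 circ Dhub' bb' aa' pq' uDq' sDq' tC xt; split.
have rem2 t s : t \notin D ++ q -> edge x t -> edge t s -> s != x -> remote D x a' b' s.
  move=> tC xt ts sx.
  have [h1 h2] := sep2 N_gt2 circ claw_heavy Dhub eD aa' bb' pq uDq sDq tC xt ts sx.
  rewrite -(perm_mem pqp) in tC.
  have [_ h3] := sep2 N_gt2 circ claw_heavy Dhub' eD' bb' aa' pq' uDq' sDq' tC xt ts sx.
  by split.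
move: (uDq); rewrite cat_uniq => /and3P[_ /hasPn Dq _].
have a'D : a' \notin D by apply/Dq/(walk_mem1 pq).
have b'D : b' \notin D by apply/Dq/(walk_mem2 pq).
have wD : w \notin D by move: wC; rewrite mem_cat negb_or => /andP[].
have [ab xa xb] : [/\ a != b, x != a & x != b].
  by move: uabx; rewrite /= !inE negb_or !(eq_sym x) => /and3P[/andP[-> ->] ->].
have [p1 [p2 [n1 [n2 [[xp1 xp2 p12] pn1 pn2 unet [[xn1 xn2 n12] p1n2 p2n1 far]]]]]] :=
  tripod claw_heavy N_heavy xD ab xa xb eD light a'D b'D aa' bb' maxa maxb a'b' maxab wD
    xw
    (rem1 _ wC xw).
have memC t : (t \in x :: l) = (t \in D ++ q) by rewrite (perm_mem pS).
have uxl : uniq (x :: l) by rewrite (perm_uniq pS).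
have sxl : size (x :: l) = N by rewrite (perm_size pS).
have far6 t : remote D x a' b' t ->
    {in [:: u1; v1; p1; p2; n1; n2], forall s, ~~ ore t s}.
  move=> rt s; have [h _ _] := rt; have [h3 h4 h5 h6] := far t rt.
  have hu := h u1 u1D _; have hv := h v1 v1D _.
  rewrite !inE => /or4P[/eqP->|/eqP->|/eqP->|/or3P[]/eqP->] //.
  - by apply: hu; rewrite eq_sym (edge_neq xu).
  - by apply: hv; rewrite (edge_neq vx).
apply: (endgame N_gt2 circ claw_heavy N_heavy H_heavy pl xu vx uv uxl sxl xp1 xp2 p12
  pn1 pn2
  unet xn1 xn2 n12 p1n2 p2n1 _ _ (w := w) (v := v)) => //; rewrite ?memC //.
- by move=> t; rewrite memC => tC xt; apply/far6/rem1.
- by move=> t s; rewrite memC => tC xt ts sx; apply/far6/(rem2 t).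
Qed.

(** A theta graph with its two branch vertices blown up to hubs: [D1], [q1], [D2], [q2] make up the
    cycle of length [N], and [P] is the path outside it. *)
Definition config D1 a1 b1 x D2 a2 b2 y q1 q2 P : Prop :=
  [/\ side D1 a1 b1 x (D1 ++ q1 ++ q2 ++ D2), side D2 a2 b2 y (D1 ++ q1 ++ q2 ++ D2),
      [/\ arc edge a1 q1 a2, arc edge b1 q2 b2 & arc edge x P y],
      uniq ((D1 ++ q1 ++ q2 ++ D2) ++ P) &
      size (D1 ++ q1 ++ q2 ++ D2) = N /\ 0 < size P].

Lemma side_perm D a b x S S' : perm_eq S S' -> side D a b x S -> side D a b x S'.
Proof.
move=> SS' [h e u [u1 [v1 [l [pl xu vx uv [pS u1D v1D]]]]]]; split=> //.
by exists u1, v1, l; split=> //; split=> //; apply: perm_trans SS'.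
Qed.

Lemma side_swap D a b x S : side D a b x S -> side D b a x S.
Proof.
case=> h e u hl; split=> //; first exact: hub_swap.
- exact: ham_walk_sym.
- by congr is_true: u; apply: perm_uniq; perm_solve.
Qed.

Lemma config_swap D1 a1 b1 x D2 a2 b2 y q1 q2 P :
  config D1 a1 b1 x D2 a2 b2 y q1 q2 P -> config D1 b1 a1 x D2 b2 a2 y q2 q1 P.
Proof.
case=> s1 s2 [aq1 aq2 aP] u [s P0].
have pS : perm_eq (D1 ++ q1 ++ q2 ++ D2) (D1 ++ q2 ++ q1 ++ D2) by perm_solve.
split=> //.
- exact/(side_perm pS)/side_swap.
- exact/(side_perm pS)/side_swap.
- by congr is_true: u; apply: perm_uniq; perm_solve.
- by rewrite -(perm_size pS).
Qed.

Lemma config_flip D1 a1 b1 x D2 a2 b2 y q1 q2 P :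
  config D1 a1 b1 x D2 a2 b2 y q1 q2 P ->
  config D2 a2 b2 y D1 a1 b1 x (rev q1) (rev q2) (rev P).
Proof.
case=> s1 s2 [aq1 aq2 aP] u [s P0].
have pS : perm_eq (D1 ++ q1 ++ q2 ++ D2) (D2 ++ rev q1 ++ rev q2 ++ D1) by perm_solve.
split.
- exact: (side_perm pS).
- exact: (side_perm pS).
- by split; apply: arc_rev.
- by congr is_true: u; apply: perm_uniq; perm_solve.
- by rewrite -(perm_size pS) size_rev.
Qed.

Lemma config_grow D1 a1 b1 x D2 a2 b2 y a' r1 q2 P d :
  config D1 a1 b1 x D2 a2 b2 y (a' :: r1) q2 P ->
  d \in D1 -> d != a1 -> ore a' d ->
  config (a' :: D1) a' b1 x D2 a2 b2 y r1 q2 P.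
Proof.
case=> s1 s2 [aq1 aq2 aP] u [s P0] dD da ad.
have pS : perm_eq (D1 ++ (a' :: r1) ++ q2 ++ D2) ((a' :: D1) ++ r1 ++ q2 ++ D2) by
  perm_solve.
have /andP[aa' ar1] : edge a1 a' && arc edge a' r1 a2 by [].
have u' : uniq (a' :: D1 ++ (r1 ++ q2 ++ D2) ++ P).
  by congr is_true: u; apply: perm_uniq; perm_solve.
have a'D : a' \notin D1 by move: u'; rewrite cons_uniq mem_cat negb_or => /andP[/andP[]].
have [h1 e1 u1 [u0 [v0 [l [pl xu vx uv [pS1 uD vD]]]]]] := s1.
have [_ bD xD] := hub_mem h1.
split=> //.
- split.
  + exact: (hub_grow osym h1 a'D (edge_ore aa') dD da ad).
  + exact: (ham_walk_cons esym aa' e1).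
  + move: u1; rewrite /= !inE !negb_or => /and3P[_ -> _]; rewrite !andbT.
    by apply/andP; split; apply: contraNneq a'D => ->.
  + exists u0, v0, l; split=> //; split; rewrite ?inE ?uD ?vD ?orbT //.
    exact: perm_trans pS.
- exact: (side_perm pS).
- by congr is_true: u; apply: perm_uniq; perm_solve.
- by rewrite -(perm_size pS).
Qed.

Lemma config_rung D1 a1 b1 x D2 a2 b2 y a' r1 b' r2 P :
  config D1 a1 b1 x D2 a2 b2 y (a' :: r1) (b' :: r2) P -> ore a' b' ->
  config [:: a', b' & D1] a' b' x D2 a2 b2 y r1 r2 P.
Proof.
case=> s1 s2 [aq1 aq2 aP] u [s P0] ab.
have pS : perm_eq (D1 ++ (a' :: r1) ++ (b' :: r2) ++ D2) ([:: a', b' & D1] ++ r1 ++ r2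
  ++ D2).
  by perm_solve.
have /andP[aa' ar1] : edge a1 a' && arc edge a' r1 a2 by [].
have /andP[bb' ar2] : edge b1 b' && arc edge b' r2 b2 by [].
have u' : uniq [:: a', b' & D1 ++ (r1 ++ r2 ++ D2) ++ P].
  by congr is_true: u; apply: perm_uniq; perm_solve.
move: u'; rewrite !cons_uniq inE !mem_cat !negb_or => /and3P[/and3P[a'b' a'D _]
  /andP[b'D _] _].
have [h1 e1 u1 [u0 [v0 [l [pl xu vx uv [pS1 uD vD]]]]]] := s1.
have [_ bD xD] := hub_mem h1.
split=> //.
- split.
  + exact: (hub_rung osym h1 a'D b'D (edge_ore aa') (edge_ore bb') ab).
  + apply: (ham_walk_cons esym aa'); apply: (ham_walk_sym esym);
    apply: (ham_walk_cons esym bb').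
    exact: (ham_walk_sym esym).
  + rewrite /= !inE !negb_or a'b' !andbT.
    by apply/andP; split; [apply: contraNneq a'D => -> | apply: contraNneq b'D => ->].
  + exists u0, v0, l; split=> //; split; rewrite ?inE ?uD ?vD ?orbT //.
    exact: perm_trans pS.
- exact: (side_perm pS).
- by congr is_true: u; apply: perm_uniq; perm_solve.
- by rewrite -(perm_size pS).
Qed.

(** If [q1] were empty, spanning walks of the hubs from [b1] to [x] and from [b2] to [y], joined by
    [q2] and [P], would contain the whole cycle and [P]. *)
Lemma config_arcs D1 a1 b1 x D2 a2 b2 y q1 q2 P :
  config D1 a1 b1 x D2 a2 b2 y q1 q2 P -> 0 < size q1.
Proof.
case=> [[h1 _ _ _]] [h2 _ _ _] [aq1 aq2 aP] u [s P0].
rewrite lt0n; apply/negP => /nilP eq1; subst q1.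
have [_ _ hbx _] := h1; have [_ _ hby _] := h2.
apply: (theta_two osym N_gt2 circ hbx hby (arc_ore aq2) (arc_ore aP) _ u).
  by perm_solve.
by rewrite size_cat s -addn1 leq_add2l.
Qed.

Definition light (D : seq G) : bool :=
  all (fun u => all (fun v => (u == v) || (degree u + degree v < #|G|)) D) D.

Lemma lightP D : light D -> {in D &, forall u v, ore u v -> edge u v}.
Proof.
move=> /allP lD u v /lD/allP lu /lu; rewrite /ore; case: eqP => //= _.
by rewrite ltnNge => /negbTE ->; rewrite orbF.
Qed.

(* Two heavy pairs, one in each hub, have total degree at least [2 * #|G|]; this
   yields two ore edges between the hubs that share an end, and at most one of
   them joins corresponding terminals. *)
Lemma config_light D1 a1 b1 x D2 a2 b2 y q1 q2 P :
  config D1 a1 b1 x D2 a2 b2 y q1 q2 P -> light D1 \/ light D2.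
Proof.
case=> [[h1 _ t1 _]] [h2 _ t2 _] [aq1 aq2 aP] u [s P0].
case: (boolP (light D1)) => [|/allPn[u1 u1D /allPn[v1 v1D]]]; first by left.
rewrite negb_or -leqNgt => /andP[uv1 d1].
case: (boolP (light D2)) => [|/allPn[u2 u2D /allPn[v2 v2D]]]; first by right.
rewrite negb_or -leqNgt => /andP[uv2 d2].
have disj d e : d \in D1 -> e \in D2 -> d != e.
  move=> dD eD; apply/eqP => de; move: u; rewrite cat_uniq => /and3P[+ _ _].
  rewrite cat_uniq => /and3P[_ /hasPn/(_ e)]; rewrite !mem_cat eD !orbT => /(_ isT) /=.
  by rewrite -de dD.
have [a1b1 a1x b1x] : [/\ a1 != b1, a1 != x & b1 != x].
  by move: t1; rewrite /= !inE negb_or => /and3P[/andP[]].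
have [a2b2 a2y b2y] : [/\ a2 != b2, a2 != y & b2 != y].
  by move: t2; rewrite /= !inE negb_or => /and3P[/andP[]].
have cross d e : d \in D1 -> e \in D2 -> #|G| <= degree d + degree e ->
    [\/ d = a1 /\ e = a2, d = b1 /\ e = b2 | d = x /\ e = y].
  move=> dD eD de.
  apply: (hub_cross osym N_gt2 circ h1 h2 (arc_ore aq1) (arc_ore aq2) (arc_ore aP) _ u)
    => //.
  - by perm_solve.
  - by rewrite size_cat s -addn1 leq_add2l.
  - by rewrite /ore disj // de orbT.
have inj1 d e e' : d \in D1 -> e \in D2 -> e' \in D2 -> e != e' ->
    #|G| <= degree d + degree e -> #|G| <= degree d + degree e' -> False.
  move=> dD eD eD' ee' /(cross _ _ dD eD) c /(cross _ _ dD eD') c'.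
  case: c c' => -[-> ee] [] [ed e'e]; move: ee'; rewrite ee e'e ?eqxx //;
    by move: a1b1 a1x b1x; rewrite ?ed ?eqxx // -?ed ?eqxx.
have inj2 d d' e : d \in D1 -> d' \in D1 -> e \in D2 -> d != d' ->
    #|G| <= degree d + degree e -> #|G| <= degree d' + degree e -> False.
  move=> dD dD' eD dd' /(cross _ _ dD eD) c /(cross _ _ dD' eD) c'.
  case: c c' => -[dd ->] [] [d'd ed]; move: dd'; rewrite dd d'd ?eqxx //;
    by move: a2b2 a2y b2y; rewrite ?ed ?eqxx // -?ed ?eqxx.
exfalso.
(* In each pairing of the two heavy pairs the two sums add up to at least [2 * #|G|], so one of them
   is large. *)
case: (leqP #|G| (degree u1 + degree u2)) => huu;
case: (leqP #|G| (degree u1 + degree v2)) => huv.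
- exact: (inj1 u1 u2 v2).
- have hvu : #|G| <= degree v1 + degree u2 by move: huv d1 d2; clear; lia.
  exact: (inj2 u1 v1 u2).
- have hvv : #|G| <= degree v1 + degree v2 by move: huu d1 d2; clear; lia.
  exact: (inj2 u1 v1 v2).
- have hvu : #|G| <= degree v1 + degree u2 by move: huv d1 d2; clear; lia.
  have hvv : #|G| <= degree v1 + degree v2 by move: huu d1 d2; clear; lia.
  exact: (inj1 v1 u2 v2).
Qed.

Lemma config_saturated D1 a1 b1 x D2 a2 b2 y a' r1 b' r2 P :
  config D1 a1 b1 x D2 a2 b2 y (a' :: r1) (b' :: r2) P ->
  saturated D1 a1 b1 a' b' -> light D1 -> False.
Proof.
case=> s1 sy [aq1 aq2 aP] u [sN P0] sat lD1.
have [_ [s ps sD2] _ _] := sy.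
have /andP[aa' ar1] : edge a1 a' && arc edge a' r1 a2 by [].
have /andP[bb' ar2] : edge b1 b' && arc edge b' r2 b2 by [].
(* Seen from the first hub, the rest of the cycle is one walk [q], which crosses [D2] along its
   spanning edge walk. *)
have pq : walk edge a' b' ([:: a'] ++ r1 ++ s ++ rev r2 ++ [:: b']).
  exact: (arc_cat (walk1 _ a') ar1 (arc_cat ps (arc_rev esym ar2) (walk1 _ b'))).
set q := _ ++ _ in pq.
have pS : perm_eq (D1 ++ (a' :: r1) ++ (b' :: r2) ++ D2) (D1 ++ q) by rewrite /q;
  perm_solve.
have uq : uniq ((D1 ++ q) ++ P).
  by congr is_true: u; apply: perm_uniq; rewrite /q; perm_solve.
have [uS offP] : uniq (D1 ++ q) /\ {in P, forall t, t \notin D1 ++ q}.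
  by move: uq; rewrite cat_uniq => /and3P[-> /hasPn h _].
have [a'q b'q] : a' != b' /\ {in D2, forall t, t \notin D1}.
  move: uS; rewrite /q cat_uniq => /and3P[_ /hasPn qD uq']; split.
    by move: uq'; rewrite /= !mem_cat inE !negb_or => /andP[/and4P[_ _ _ ->]].
  move=> t tD; apply: (qD t).
  by rewrite !mem_cat -(perm_mem sD2) in tD *; rewrite tD !orbT.
case: P P0 aP uq {u} offP => [//|w P] _ aP uq offP.
have /andP[xw aP'] : edge x w && arc edge w P y by [].
have xD : x \in D1 by case: s1 => /hub_mem[].
have yD : y \in D2 by case: sy => /hub_mem[].
(* The leg consists of the first two vertices of [P], or of [w] and [y] if [P] is a single
   vertex. *)
have [v wv vx] : exists2 v, edge w v & v != x.
  case: P aP' {aP uq} offP => [|v P] aP offP.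
    exists y; first by move: aP; rewrite /arc /= andbT.
    by apply: contraNneq (b'q y yD) => ->.
  have /andP[wv _] : edge w v && arc edge v P y by [].
  exists v => //; have := offP v; rewrite !inE eqxx orbT => /(_ isT).
  by apply: contraNneq => ->; rewrite mem_cat xD.
apply: (side_saturated (side_perm pS s1) sat (lightP lD1) aa' bb' a'q pq uS _ _ xw wv vx).
  by rewrite -(perm_size pS).
by apply: offP; rewrite mem_head.
Qed.

(** Induction on the total length of the two arcs on the cycle: each growth step shortens it, and
    where no step applies a light hub yields the contradiction. *)
Lemma config_false D1 a1 b1 x D2 a2 b2 y q1 q2 P :
  ~ config D1 a1 b1 x D2 a2 b2 y q1 q2 P.
Proof.
have [k] := ubnP (size q1 + size q2).
elim: k D1 a1 b1 x D2 a2 b2 y q1 q2 P => [//|k IH] D1 a1 b1 x D2 a2 b2 y q1 q2 P ltk c.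
have grown D1' a1' b1' x' D2' a2' b2' y' a' r1 q2' P' :
    size (a' :: r1) + size q2' < k.+1 ->
    config D1' a1' b1' x' D2' a2' b2' y' (a' :: r1) q2' P' ->
    forall d, d \in D1' -> d != a1' -> ~~ ore a' d.
  move=> szk c' d dD da; apply/negP => ad.
  by apply: (IH _ _ _ _ _ _ _ _ _ _ _ _ (config_grow c' dD da ad)).
(* Stated for an arbitrary configuration, so that it also applies after [config_flip] when the
   second hub is the light one. *)
have step D1' a1' b1' x' D2' a2' b2' y' q1' q2' P' : size q1' + size q2' < k.+1 ->
    config D1' a1' b1' x' D2' a2' b2' y' q1' q2' P' -> light D1' -> False.
  move=> szk c' lD; have cs := config_swap c'.
  have := config_arcs c'; have := config_arcs cs.
  case: q1' q2' szk c' cs => [|a' r1] [|b' r2] //= szk c' cs _ _.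
  apply: (config_saturated c') => //; split.
  - by apply: (grown _ _ _ _ _ _ _ _ _ _ _ _ _ c').
  - by apply: (grown _ _ _ _ _ _ _ _ _ _ _ _ _ cs); rewrite addnC.
  - apply/negP => ab; apply: (IH _ _ _ _ _ _ _ _ _ _ _ _ (config_rung c' ab)).
    by move: szk; clear; lia.
case: (config_light c) => lD; first exact: (step _ _ _ _ _ _ _ _ _ _ _ ltk c).
by apply: (step _ _ _ _ _ _ _ _ _ _ _ _ (config_flip c)); rewrite // !size_rev.
Qed.

End Config.

(** * The initial theta graph *)

Section Initial.
Variables (G : sgraph) (N : nat).
Hypotheses (N_gt2 : 2 < N).
Hypothesis circ : forall p : seq G, uniq p -> 2 < size p -> cycle ore p -> size p <= N.
Hypothesis (claw_heavy : graph_heavy K13 G).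

Let osym := @ore_sym G.
Let esym := @edge_sym G.

(** Claw-freeness at [x] with leaves [u], [v], [w]: if [w] were ore-adjacent to [u] or [v], it could
    be inserted between that vertex and [x]. *)
Lemma tip_ore (x u v w : G) l : walk edge u v l -> edge x u -> edge v x -> edge x w ->
  uniq (w :: x :: l) -> size (x :: l) = N -> ore u v.
Proof.
move=> pl xu vx xw uw sl.
have sw : N < size (w :: x :: l) by rewrite -sl.
have xv : edge x v by rewrite esym.
have uv : u != v.
  case/walkP: pl sl uw => t [-> _ <-]; case/lastP: t => [|t c] sl.
    by move: N_gt2; rewrite -sl.
  rewrite last_rcons => uw; have {uw} : uniq [:: w, x, u & rcons t c] by [].
  by rewrite !cons_uniq mem_rcons inE negb_or => /and4P[_ _ /andP[]].
have u3 : uniq [:: u; v; w].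
  have [wu wv] : w != u /\ w != v.
    move: uw; rewrite cons_uniq inE negb_or => /andP[/andP[_ wl] _].
    by split; apply: contraNneq wl => ->; [apply: walk_mem1 pl | apply: walk_mem2 pl].
  by rewrite /= !inE negb_or uv /= !(eq_sym _ w) wu wv.
case/or3P: (claw_ore claw_heavy xu xv xw u3) => // h; exfalso.
- have c := walk_cons (edge_ore xw) (walk_cons (_ : ore w u) (walk_ore pl)).
  apply: (no_long_cycle N_gt2 circ (c _) (edge_ore vx) _ uw sw); first by rewrite osym.
  by perm_solve.
- have c := walk_rcons (walk_cons (edge_ore xu) (walk_ore pl)) h.
  apply: (no_long_cycle N_gt2 circ c _ _ uw sw); first by rewrite osym edge_ore.
  by perm_solve.
Qed.

Lemma arc_size (x y : G) l1 l2 P : arc edge x l1 y -> arc edge x l2 y -> arc edge x P y ->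
  0 < size P -> uniq (x :: y :: l1 ++ l2 ++ P) -> (size l1 + size l2).+2 = N ->
  0 < size l1.
Proof.
move=> a1 a2 aP P0 u s; rewrite lt0n; apply/negP => /nilP e1; subst l1.
have p1 := arc_cat (walk1 _ x) (arc_ore a2) (walk1 _ y).
apply: (no_long_arc N_gt2 circ p1 (arc_rev osym (arc_ore aP)) _ u); first by perm_solve.
by move: s P0; rewrite /= !size_cat; clear; move: (size l2) (size P) => *; lia.
Qed.

(** With [m] empty, the cycle through [P], [y], [c], [d] and [l2] would be longer than [N]. Two
    interior vertices on each arc make room for disjoint triangles at [x] and [y]. *)
Lemma arc_size2 (x y c d v : G) m l2 P : arc edge x (rcons m c) y ->
  edge y d -> walk edge d v l2 -> edge v x -> arc edge x P y -> ore c d ->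
  0 < size P -> uniq (x :: y :: rcons m c ++ l2 ++ P) ->
  (size (rcons m c) + size l2).+2 = N -> 0 < size m.
Proof.
move=> a1 yd pl vx aP cd P0 u s; rewrite lt0n; apply/negP => /nilP e1; subst m.
have yc : ore y c by rewrite osym edge_ore //; move: a1; rewrite /arc /= => /and3P[].
have p1 := arc_cat (walk1 _ x) (arc_ore aP) (walk_cons yc (walk_cons cd (walk_ore pl))).
apply: (no_long_cycle N_gt2 circ p1 (edge_ore vx) _ u); first by perm_solve.
by move: s P0; rewrite /= !size_cat; clear; move: (size l2) (size P) => *; lia.
Qed.

(** The initial hubs are [x] and [y] with their cycle neighbours, triangles by [tip_ore]. The list
    [k2] is reversed because both arcs of a configuration run from the first hub to the second. *)
Lemma theta_ends (x y u1 c d v1 : G) k1 k2 P :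
  arc edge x (u1 :: rcons k1 c) y -> arc edge y (d :: rcons k2 v1) x ->
  arc edge x P y -> 0 < size P ->
  uniq (x :: (u1 :: rcons k1 c) ++ y :: (d :: rcons k2 v1) ++ P) ->
  size (x :: (u1 :: rcons k1 c) ++ y :: (d :: rcons k2 v1)) = N ->
  config N [:: u1; v1; x] u1 v1 x [:: c; d; y] c d y k1 (rev k2) P.
Proof.
move=> a1 a2 aP P0 u s.
have pl1 := arc_walk a1; have pl2 := arc_walk a2.
have [xu1 uc cy] : [/\ edge x u1, arc edge u1 k1 c & edge c y].
  by move: a1; rewrite -rcons_cons arc_rcons => /andP[/andP[]].
have [yd dv v1x] : [/\ edge y d, arc edge d k2 v1 & edge v1 x].
  by move: a2; rewrite -rcons_cons arc_rcons => /andP[/andP[]].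
have plx := walk_cat pl1 cy (walk_cons yd pl2).
have ply := walk_cat pl2 v1x (walk_cons xu1 pl1).
have pS : perm_eq (x :: (u1 :: rcons k1 c) ++ y :: d :: rcons k2 v1)
  ([:: u1; v1; x] ++ k1 ++ rev k2 ++ [:: c; d; y]) by perm_solve.
have pS' : perm_eq (y :: (d :: rcons k2 v1) ++ x :: u1 :: rcons k1 c)
  ([:: u1; v1; x] ++ k1 ++ rev k2 ++ [:: c; d; y]) by perm_solve.
have uv : ore u1 v1.
  case: P P0 aP u => [//|w P] _ /andP[xw _] u.
  apply: (tip_ore plx xu1 v1x xw _ s).
  by apply: (@uniq_catl _ _ P); congr is_true: u; apply: perm_uniq; perm_solve.
have dc : ore d c.
  case/lastP: P P0 aP u => [//|P w] _ aP u.
  have yw : edge y w by move: aP; rewrite arc_rcons esym => /andP[].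
  apply: (tip_ore ply yd cy yw).
    by apply: (@uniq_catl _ _ P); congr is_true: u; apply: perm_uniq; perm_solve.
  by rewrite -s (perm_size pS) (perm_size pS').
have uS : uniq (([:: u1; v1; x] ++ k1 ++ rev k2 ++ [:: c; d; y]) ++ P).
  by congr is_true: u; apply: perm_uniq; perm_solve.
split=> //.
- split.
  + have u1x : ore u1 x by rewrite osym edge_ore.
    exact: (hub_triangle osym uv u1x (edge_ore v1x)).
  + exists [:: u1; x; v1]; last by perm_solve.
    by rewrite /= !eqxx esym xu1 esym v1x.
  + by move: uS; rewrite -catA; apply: uniq_catl.
  + exists u1, v1, ((u1 :: rcons k1 c) ++ y :: d :: rcons k2 v1).
    by split; rewrite // !inE !eqxx ?orbT.
- split.
  + have cd : ore c d by rewrite osym.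
    have dy : ore d y by rewrite osym edge_ore.
    exact: (hub_triangle osym cd (edge_ore cy) dy).
  + exists [:: c; y; d]; last by perm_solve.
    by rewrite /= !eqxx cy yd.
  + apply: (@uniq_catl _ _ (([:: u1; v1; x] ++ k1 ++ rev k2) ++ P)).
    by congr is_true: uS; apply: perm_uniq; perm_solve.
  + exists d, c, ((d :: rcons k2 v1) ++ x :: u1 :: rcons k1 c).
    by split; rewrite // !inE !eqxx ?orbT.
- by split=> //; apply: arc_rev.
- by rewrite -(perm_size pS).
Qed.

Lemma theta_config (x y : G) l1 l2 P : arc edge x l1 y -> arc edge y l2 x ->
  arc edge x P y -> 0 < size P -> uniq (x :: l1 ++ y :: l2 ++ P) ->
  size (x :: l1 ++ y :: l2) = N ->
  exists D1 a1 b1 D2 a2 b2 q1 q2, config N D1 a1 b1 x D2 a2 b2 y q1 q2 P.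
Proof.
move=> a1 a2 aP P0 u s.
have a2' := arc_rev esym a2.
have s1 : (size l1 + size l2).+2 = N by rewrite -s /= size_cat /= addnS.
have l1_gt0 : 0 < size l1.
  apply: (arc_size a1 a2' aP P0); last by rewrite size_rev.
  by congr is_true: u; apply: perm_uniq; perm_solve.
have l2_gt0 : 0 < size (rev l2).
  apply: (arc_size a2' a1 aP P0); last by rewrite size_rev addnC.
  by congr is_true: u; apply: perm_uniq; perm_solve.
rewrite size_rev in l2_gt0.
case: l1 l1_gt0 a1 u s s1 => [//|u1 l1] _ a1 u s s1.
case/lastP: l2 l2_gt0 a2 a2' u s s1 => [//|l2 v1] _ a2 a2' u s s1.
case: P P0 aP u => [//|w P] _ aP u.
have [m1 [c e1]] : exists m c, u1 :: l1 = rcons m c.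
  by exists (belast u1 l1), (last u1 l1); apply: lastI.
have [d [m2 e2]] : exists d m, rcons l2 v1 = d :: m.
  by case: (l2) => [|d l]; [exists v1, [::] | exists d, (rcons l v1)].
have [xu1 pl1] : edge x u1 /\ walk edge u1 c (u1 :: l1).
  split; first by case/andP: a1.
  have := a1; rewrite e1; case: m1 e1 => [|h m1] [-> _]; last exact: arc_walk.
  by rewrite walk1.
have [v1x pl2] : edge v1 x /\ walk edge d v1 (d :: m2).
  split; first by move: a2; rewrite arc_rcons => /andP[].
  have := a2; rewrite e2; case/lastP: m2 e2 => [|m2 h] e2.
    by have [_ ->] := rcons_inj (e2 : rcons l2 v1 = rcons [::] d); rewrite walk1.
  by move=> /arc_walk; rewrite -rcons_cons in e2; have [_ ->] := rcons_inj e2.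
have cy : edge c y by move: a1; rewrite e1 arc_rcons => /andP[].
have yd : edge y d by move: a2; rewrite e2 => /andP[].
have ply := walk_cat pl2 v1x (walk_cons xu1 pl1).
have dc : ore d c.
  have [z [yz zP]] : exists z, edge y z /\ z \in w :: P.
    exists (last w P); rewrite mem_last; split=> //.
    by move: aP; rewrite lastI arc_rcons esym => /andP[].
  apply: (tip_ore ply yd cy yz).
    rewrite cons_uniq; apply/andP; split.
      have : uniq ((y :: (d :: m2) ++ x :: u1 :: l1) ++ w :: P).
        by congr is_true: u; apply: perm_uniq; rewrite -e2; perm_solve.
      by rewrite cat_uniq => /and3P[_ /hasPn/(_ z zP) + _].
    apply: (@uniq_catl _ _ (w :: P)); congr is_true: u; apply: perm_uniq.
    by rewrite -e2; perm_solve.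
  by rewrite -s -e2; apply: perm_size; perm_solve.
have [k1 ek1] : exists k1, u1 :: l1 = u1 :: rcons k1 c.
  have : 0 < size m1.
    apply: (arc_size2 (d := d) _ yd pl2 v1x aP _ _ (c := c)); rewrite -?e1 // 1?osym //.
      by congr is_true: u; apply: perm_uniq; rewrite -e2; perm_solve.
    by rewrite -s1 -e2.
  by case: m1 e1 => [//|h m1] [-> ->] _; exists m1.
have [k2 ek2] : exists k2, rcons l2 v1 = d :: rcons k2 v1.
  have : 0 < size (rev m2).
    have a2r : arc edge x (rcons (rev m2) d) y by rewrite -rev_cons -e2.
    have yc : edge y c by rewrite esym.
    have u1x : edge u1 x by rewrite esym.
    apply: (arc_size2 a2r yc (walk_rev esym pl1) u1x aP dc) => //.
      by congr is_true: u; apply: perm_uniq; rewrite -rev_cons -e2; perm_solve.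
    by rewrite -rev_cons -e2 !size_rev addnC.
  rewrite size_rev; case/lastP: m2 e2 {pl2 ply} => [//|m2 h] e2 _; exists m2.
  by move: (e2); rewrite -rcons_cons => /rcons_inj[_ hv]; rewrite e2 hv.
rewrite ek1 ek2 in a1 a2 u s.
by do 8!eexists; apply: theta_ends a1 a2 aP _ u s.
Qed.

End Initial.

(** * Paths and longest cycles in a 2-connected graph *)

Section TwoConnected.
Variable G : sgraph.
Hypothesis hconn : k_connected 2 G.

Lemma path_avoiding (X : {set G}) (u v : G) : #|X| < 2 -> u \notin X -> v \notin X ->
  exists p, [/\ walk edge u v p, uniq p & {in p, forall t, t \notin X}].
Proof.
case: hconn => _ + X2 uX vX => /(_ X X2) conn.
have uX' : u \in ~: X by rewrite inE.
have vX' : v \in ~: X by rewrite inE.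
have /connectP[p0 pp0 lp0] := conn (exist _ u uX' : induced (~: X)) (exist _ v vX').
case/shortenP: pp0 lp0 => p pp up _ lp.
exists (map val ((exist _ u uX' : induced (~: X)) :: p)); split.
- apply/walkP; exists (map val p); split=> //.
    by apply: (homo_path (f := val) (e := @edge (induced (~: X)))) pp.
  by rewrite -[u]/(val (exist (fun t => t \in ~: X) u uX')) last_map -lp.
- by rewrite map_inj_uniq //; apply: val_inj.
- by move=> t /mapP[z _ ->]; have := valP z; rewrite inE.
Qed.

Lemma walk_next (u v : G) p : walk edge u v p -> u != v -> exists2 w, edge u w & w \in p.
Proof.
case/walkP=> [[|w t]] [-> pt lt] uv; first by rewrite -lt eqxx in uv.
by exists w; [case/andP: pt | rewrite !inE eqxx orbT].
Qed.

Lemma first_hit (S : pred G) (u v : G) p : walk edge u v p -> ~~ S u -> S v ->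
  exists p1 a b p2, [/\ p = rcons p1 a ++ b :: p2, ~~ has S (rcons p1 a) & S b].
Proof.
move=> pp uS vS; have hS : has S p by apply/hasP; exists v; rewrite ?(walk_mem2 pp).
case: (split_find hS) pp => b s1 s2 Sb nS pp.
case/lastP: s1 nS pp => [|s1 a] nS pp.
  by case/walkP: pp => t [[bu _] _ _]; rewrite bu (negbTE uS) in Sb.
by exists s1, a, b, s2; rewrite -cat_rcons.
Qed.

(** A vertex [a] has two neighbours [a1], [a2], the second found on a path avoiding [a1]; a path
    from [a1] to [a2] avoiding [a] closes up to a cycle. *)
Lemma exists_cycle : exists c : seq G, [/\ uniq c, 2 < size c & cycle edge c].
Proof.
have n2 : 2 < #|G| by case: hconn.
have pick2 (a b : G) : exists t, t \notin [:: a; b].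
  apply/existsP; rewrite -negb_forall; apply/negP => /forallP all_ab.
  by have := card_size [:: a; b]; rewrite (eq_cardT all_ab) -cardT leqNgt n2.
have [a _] : exists a : G, a \in G by apply/card_gt0P; apply: leq_trans n2.
have [b] := pick2 a a; rewrite !inE orbb eq_sym => ab.
have s0 : #|@set0 G| < 2 by rewrite cards0.
have inS0 (t : G) : t \notin set0 by rewrite in_set0.
have [p [pp _ _]] := path_avoiding s0 (inS0 a) (inS0 b).
have [a1 aa1 _] := walk_next pp ab.
have [t] := pick2 a a1; rewrite !inE negb_or => /andP[ta ta1].
have aX : a \notin [set a1] by rewrite inE (edge_neq aa1).
have tX : t \notin [set a1] by rewrite inE.
have X1 (z : G) : #|[set z]| < 2 by rewrite cards1.
have [p' [pp' _ av]] := path_avoiding (X1 a1) aX tX.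
have at' : a != t by rewrite eq_sym.
have [a2 aa2 /av] := walk_next pp' at'; rewrite inE => a21.
have b1 : a1 \notin [set a] by rewrite inE eq_sym (edge_neq aa1).
have b2 : a2 \notin [set a] by rewrite inE eq_sym (edge_neq aa2).
have [r [pr ur avr]] := path_avoiding (X1 a) b1 b2.
exists (a :: r); split.
- by rewrite cons_uniq ur andbT; apply/negP => /avr; rewrite inE eqxx.
- case/walkP: pr {ur avr} => -[|z s] [-> _ lt] //.
  by rewrite -lt /= eqxx in a21.
- have := walk_cons aa1 pr; rewrite edge_sym in aa2; move/walk_cycle; exact.
Qed.

Lemma longest_cycle : exists c : seq G, [/\ uniq c, 2 < size c, cycle edge c &
  forall p : seq G, uniq p -> 2 < size p -> cycle edge p -> size p <= size c].
Proof.
pose Pc m := [exists t : m.-tuple G, [&& uniq t, 2 < m & cycle edge t]].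
have PcP (p : seq G) : uniq p -> 2 < size p -> cycle edge p -> Pc (size p).
  by move=> up sp cp; apply/existsP; exists (in_tuple p); rewrite /= up sp cp.
have exP : exists m, Pc m.
  by have [c [uc sc cc]] := exists_cycle; exists (size c); apply: PcP.
have bound m : Pc m -> m <= #|G|.
  case/existsP=> t /and3P[ut _ _].
  by rewrite -(size_tuple t) -(card_uniqP ut) max_card.
case: (ex_maxnP exP bound) => m /existsP[t /and3P[ut m2 ct]] mmax.
exists t; rewrite size_tuple; split=> // p up sp cp.
by apply: mmax; apply: PcP.
Qed.

End TwoConnected.

Theorem theorem9 (G : sgraph) (hconn : k_connected 2 G)
    (hheavy : family_heavy (fun H => [\/ H = K13, H = N112 | H = H11]) G) :
  hamiltonian G.
Proof.
have hK : graph_heavy K13 G by apply: hheavy; constructor 1.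
have hN : graph_heavy N112 G by apply: hheavy; constructor 2.
have hH : graph_heavy H11 G by apply: hheavy; constructor 3.
have [C [uC sC cC maxC]] := longest_cycle hconn.
case: (boolP [exists z, z \notin C]) => [/existsP[z zC]|]; last first.
  rewrite negb_exists => /forallP all_in; exists C; split=> //; first exact/andP.
  by move=> y; have := all_in y; rewrite negbK.
exfalso.
have circ (p : seq G) : uniq p -> 2 < size p -> cycle ore p -> size p <= size C.
  move=> up sp /(ore_cycle_edge up sp)[p' [up' cp' sp']].
  exact: leq_trans sp' (maxC p' up' (leq_trans sp sp') cp').
have s0 : #|@set0 G| < 2 by rewrite cards0.
have inS0 (t : G) : t \notin set0 by rewrite in_set0.
have [c0 c0C] : exists c0, c0 \in C.
  by case: (C) sC => // c0 C' _; exists c0; rewrite mem_head.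
(* A path from [z] to the cycle gives an outside vertex [w] with a neighbour [x] on the cycle; a
   path from [w] avoiding [x] then reaches the cycle at another vertex [y]. *)
have [p [pp _ _]] := path_avoiding hconn s0 (inS0 z) (inS0 c0).
have [p1 [w [x [p2 [ep wC xC]]]]] := first_hit (S := mem C) pp zC c0C.
have xw : edge x w by move: pp; rewrite ep => /walk_split[_ + _]; rewrite edge_sym.
have {}wC : w \notin C by apply: contraNN wC => wC; apply/hasP; exists w;
  rewrite ?mem_rcons ?mem_head.
have [i l rotC] := rot_to xC.
have memC t : (t \in C) = (t \in x :: l) by rewrite -rotC mem_rot.
have ul : uniq (x :: l) by rewrite -rotC rot_uniq.
have cl : cycle edge (x :: l) by rewrite -rotC rot_cycle.
have sl : size (x :: l) = size C by rewrite -rotC size_rot.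
have [c1 c1l] : exists c1, c1 \in l.
  by case: (l) sl => [|c1 l'] s; [rewrite -s in sC | exists c1; rewrite mem_head].
have c1x : c1 != x by apply: contraTneq c1l => ->; case/andP: ul.
have X1 : #|[set x]| < 2 by rewrite cards1.
have wX : w \notin [set x] by rewrite inE eq_sym (edge_neq xw).
have c1X : c1 \notin [set x] by rewrite inE.
have [r [pr ur avr]] := path_avoiding hconn X1 wX c1X.
have c1C : c1 \in C by rewrite memC inE c1l orbT.
have [r1 [a [y [r2 [er rC yC]]]]] := first_hit (S := mem C) pr wC c1C.
rewrite er in pr ur avr.
have [pr1 ay _] := walk_split pr.
have yx : y != x by have := avr y; rewrite mem_cat mem_head orbT inE; apply.
have yl : y \in l by move: yC; rewrite /= memC inE (negbTE yx).
case/splitPr: yl ul cl sl memC {rotC c1l} => l1 l2 ul cl sl memC.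
set P := rcons r1 a in pr1 rC ur.
have aP : arc edge x P y.
  by case/walkP: pr1 => t [-> pt lt]; rewrite /arc /= xw rcons_path pt lt.
have P0 : 0 < size P by rewrite size_rcons.
have uP : uniq ((x :: l1 ++ y :: l2) ++ P).
  rewrite cat_uniq ul (uniq_catl ur) andbT; apply/hasPn => t tP.
  by rewrite /= -memC; apply: contraNN rC => tC; apply/hasP; exists t.
have [a1 a2] : arc edge x l1 y /\ arc edge y l2 x.
  by move: cl; rewrite /= rcons_cat cat_path => /and3P[h1 h2 h3];
    rewrite /arc rcons_path h1 h2.
have uP' : uniq (x :: l1 ++ y :: l2 ++ P).
  by congr is_true: uP; apply: perm_uniq; perm_solve.
have [D1 [u1 [v1 [D2 [u2 [v2 [q1 [q2 c]]]]]]]] :=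
  theta_config sC circ hK a1 a2 aP P0 uP' sl.
exact: (config_false sC circ hK hN hH c).
Qed.
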